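(* Let $n$ and $s$ be positive integers satisfying $n \geq \max\{2s+5, 40\}$. Define $$g(n,s)=\max\left\{ \binom{n}{2} - \binom{n - s + 1}{2} + 5,\ \binom{2s-1}{2} + n + 1 \right\}.$$ Let $H$ be an edge-colored complete graph $K_n$ in which at least $g(n,s)$ distinct colors appear on the edges. If $H$ contains no rainbow matching of size $s+2$, then $H$ contains either a monochromatic $K_{n-s}$ or a monochromatic $K_{n-2s-1} \vee \overline{K_{2s+1}}$.
   Context: All graphs are finite and simple. $K_p$ is the complete graph on $p$ vertices and $\overline{G}$ is the complement of $G$, so $\overline{K_p}$ is the edgeless graph on $p$ vertices. For vertex-disjoint graphs $G_1=(V_1,E_1)$ and $G_2=(V_2,E_2)$, the join $G_1\vee G_2$ is the graph with vertex set $V_1\cup V_2$ whose edges are those in $E_1\cup E_2$ together with all edges joining $V_1$ and $V_2$. An edge-coloring is an arbitrary assignment of colors to edges (not necessarily proper). A matching is a set of edges no two of which share a vertex; its size is its number of edges. A matching is rainbow if all its edges have distinct colors. ''$H$ contains a monochromatic $F$'' means that $H$ has a (not necessarily induced) subgraph isomorphic to $F$ all of whose edges have the same color. *)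

(* Defs.v *)
From mathcomp Require Import all_boot.

Set Implicit Arguments.
Unset Strict Implicit.
Unset Printing Implicit Defensive.

Record sgraph := SGraph {
  vertex :> finType;
  adj : rel vertex;
  adj_sym : symmetric adj;
  adj_irrefl : irreflexive adj
}.

Definition edges (G : sgraph) : {set {set G}} :=
  [set [set x; y] | x in G, y in G & adj x y].

Section Constructions.

Definition complete_adj (p : nat) : rel 'I_p := fun x y => x != y.

Lemma complete_sym p : symmetric (@complete_adj p).
Proof. by move=> x y; rewrite /complete_adj eq_sym. Qed.

Lemma complete_irrefl p : irreflexive (@complete_adj p).
Proof. by move=> x; rewrite /complete_adj eqxx. Qed.

Definition complete (p : nat) : sgraph :=
  SGraph (@complete_sym p) (@complete_irrefl p).

Definition compl_adj (G : sgraph) : rel G :=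
  fun x y => (x != y) && ~~ adj x y.

Lemma compl_sym G : symmetric (@compl_adj G).
Proof. by move=> x y; rewrite /compl_adj eq_sym adj_sym. Qed.

Lemma compl_irrefl G : irreflexive (@compl_adj G).
Proof. by move=> x; rewrite /compl_adj eqxx. Qed.

Definition compl (G : sgraph) : sgraph :=
  SGraph (@compl_sym G) (@compl_irrefl G).

Definition join_adj (G1 G2 : sgraph) : rel (G1 + G2)%type :=
  fun u v => match u, v with
  | inl x, inl y => adj x y
  | inr x, inr y => adj x y
  | _, _ => true
  end.

Lemma join_sym G1 G2 : symmetric (@join_adj G1 G2).
Proof. by case=> x [] y //=; rewrite adj_sym. Qed.

Lemma join_irrefl G1 G2 : irreflexive (@join_adj G1 G2).
Proof. by case=> x /=; rewrite adj_irrefl. Qed.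

Definition join (G1 G2 : sgraph) : sgraph :=
  SGraph (@join_sym G1 G2) (@join_irrefl G1 G2).

End Constructions.

(* A coloring is a function on all vertex sets; every notion below looks only *)
(* at its values on edges.                                                    *)
Definition edge_coloring (G : sgraph) (C : eqType) := {set G} -> C.

Section Colorings.

Variables (G : sgraph) (C : eqType) (c : edge_coloring G C).

Definition num_colors : nat := size (undup [seq c e | e in edges G]).

Definition matching (M : {set {set G}}) : bool :=
  (M \subset edges G) && trivIset M.

Definition rainbow (M : {set {set G}}) : Prop := {in M &, injective c}.

Definition has_rainbow_matching (k : nat) : Prop :=
  exists M : {set {set G}}, [/\ matching M, #|M| = k & rainbow M].

Definition monochromatic (B : {set {set G}}) : Prop :=
  {in B &, forall e1 e2, c e1 = c e2}.

(* Edge set of the subgraph of G onto which f maps F isomorphically *)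
(* when f is injective and this set is contained in edges G.        *)
Definition copy_edges (F : sgraph) (f : F -> G) : {set {set G}} :=
  [set f @: (e : {set F}) | e in edges F].

Definition has_monochromatic (F : sgraph) : Prop :=
  exists f : F -> G,
    [/\ injective f, copy_edges f \subset edges G
      & monochromatic (copy_edges f)].

End Colorings.

Definition g (n s : nat) : nat :=
  maxn ('C(n, 2) - 'C(n - s + 1, 2) + 5) ('C(2 * s - 1, 2) + n + 1).

(* Main.v *)
(* Choose a set E of edges with exactly one edge of every colour, and two vertices   *)
(* u, v of minimum degree in the graph (V, E). If e in E has the colour of uv, then   *)
(* removing u, v and e from the graph leaves no matching of size s + 1, since uv      *)
(* would extend it. The Tutte-Berge formula for this graph gives a barrier A with     *)
(* |A| <= s, and since u and v have small degree, |E| is at most the number of edges  *)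
(* compatible with the barrier plus a constant. By convexity in |A| and |E| >= g(n,s) *)
(* either |A| >= s - 1, or |A| <= 1 and outside A all remaining edges lie in one      *)
(* block of order 2(s - |A|) + 1; in both cases only few edges are missing.           *)
(* In the first case s - 1 vertices of A can be matched so flexibly that the other    *)
(* n - s + 1 vertices span no rainbow matching of size 3, while they span at least 5  *)
(* colours; this forces one vertex to meet all edges but those of one colour. In the  *)
(* second case there is an almost complete set Q of 2s vertices, in which perfect     *)
(* matchings can avoid any prescribed three colours, and Q plus one vertex contains   *)
(* all edges but those of one colour.                                                 *)

(* The graph (V, E) with one edge per colour has only rainbow matchings, so the absence of a rainbow
   matching of size s + 2 is a statement about ordinary matchings, which [barrier_structure]
   converts into a barrier A with odd blocks. Counting E against this barrier ([card_by_barrier],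
   [card_touching], [class_sum_bound], [barrier_numerics]) leaves two configurations, one for each
   term of [g]: s - 1 or s vertices joined to nearly everything ([dominating_case]), or an almost
   complete set of about 2s vertices ([clique_case]).

   Edges outside E are controlled by one exchange argument, [extend_contra]: a small rainbow
   matching N of arbitrary edges, together with a disjoint matching in E that avoids the
   representatives of the colours of N, is again rainbow. Matchings in E that survive the loss of a
   few vertices and colours ([dominating_extend] by a bipartite argument, [clique_extend] by Ore's
   condition) therefore forbid small rainbow matchings in the rest of the graph, and this makes the
   colouring constant there ([no_rainbow3_star], [clique_finish]). The outcome is a monochromatic
   set of n - s vertices, or a set W of 2s + 1 vertices such that all edges not inside W have one
   colour; the latter edges form the join. *)
Require Import Defs.
From mathcomp Require Import all_boot zify.

Set Implicit Arguments.
Unset Strict Implicit.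
Unset Printing Implicit Defensive.

(** * Maximum matchings and barriers *)

Section Involutions.
Variable T : finType.

Lemma card_pairs (f : T -> T) (S : {set T}) :
  (forall x, x \in S -> [/\ f (f x) = x, f x \in S & f x != x]) ->
  [/\ trivIset [set [set x; f x] | x in S], cover [set [set x; f x] | x in S] = S
    & #|S| = 2 * #|[set [set x; f x] | x in S]|].
Proof.
move=> fS; set M := [set _ | x in S].
have tM : trivIset M.
  apply/trivIsetP => _ _ /imsetP[x xS ->] /imsetP[y yS ->] neq.
  apply/pred0P => z /=; apply/negP; rewrite !inE => /andP[zx zy].
  case/negP: neq; apply/eqP.
  have [fx _ _] := fS _ xS; have [fy _ _] := fS _ yS.
  have aux w : f (f w) = w -> z = w \/ z = f w -> [set w; f w] = [set z; f z].
    by move=> fw [] -> //; rewrite fw setUC.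
  by rewrite (aux x) ?(aux y) //; [case/orP: zy | case/orP: zx] => /eqP; [left|right|left|right].
have cM : cover M = S.
  apply/setP=> z; apply/bigcupP/idP => [[_ /imsetP[x xS ->]]|zS].
    by rewrite !inE => /orP[] /eqP-> //; case: (fS _ xS).
  by exists [set z; f z]; [apply: imset_f | rewrite !inE eqxx].
split=> //; move: tM; rewrite /trivIset cM => /eqP <-.
rewrite (eq_bigr (fun=> 2)) ?sum_nat_const 1?mulnC //.
by move=> _ /imsetP[x xS ->]; rewrite cards2; case: (fS _ xS) => _ _; rewrite eq_sym => ->.
Qed.

End Involutions.

Section Matchings.
Variables (T : finType) (e : rel T).
Hypothesis (e_sym : symmetric e) (e_irr : irreflexive e).
Implicit Types (f g : {ffun T -> T}) (S K : {set T}).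

Definition missed f := [set x | f x == x].

(* A matching is encoded as an involution; its fixed points are the missed vertices. *)
Definition imatching f := [forall x, (f (f x) == x) && ((f x != x) ==> e x (f x))].

Definition max_imatching f := imatching f && [forall g, imatching g ==> (#|missed f| <= #|missed g|)].

Lemma imatchingP f : reflect ((forall x, f (f x) = x) /\ (forall x, f x != x -> e x (f x))) (imatching f).
Proof.
apply: (iffP forallP) => [H|[H1 H2] x].
  by split=> x; case/andP: (H x) => /eqP H1 /implyP.
by rewrite H1 eqxx; apply/implyP/H2.
Qed.

Lemma max_imatchingP f : reflect (imatching f /\ forall g, imatching g -> #|missed f| <= #|missed g|) (max_imatching f).
Proof.
apply: (iffP andP) => [[H1 /forallP H2]|[H1 H2]]; split=> //.
  by move=> g mg; move: (H2 g); rewrite mg.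
by apply/forallP=> g; apply/implyP/H2.
Qed.

Lemma max_imatching_exists f : imatching f -> exists2 g, max_imatching g & #|missed g| <= #|missed f|.
Proof.
move=> mf; case: (@arg_minnP _ f imatching (fun g => #|missed g|) mf) => g mg gmin.
by exists g; [apply/max_imatchingP | apply: gmin].
Qed.

Lemma imatching_id : imatching [ffun x => x].
Proof. by apply/imatchingP; split=> x; rewrite !ffunE ?eqxx. Qed.

Lemma card_moved f K : imatching f -> (forall x, x \in K -> f x \in K) ->
  #|K| = #|K :&: missed f| + 2 * #|[set [set x; f x] | x in K :\: missed f]|.
Proof.
move=> /imatchingP[ff _] fK.
have [|_ _ <-] := @card_pairs T f (K :\: missed f); last by rewrite cardsID.
move=> x; rewrite !inE => /andP[fx xK]; split=> //.
by rewrite fK // ff eq_sym fx.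
Qed.

Lemma card_imatching f : imatching f -> #|T| = #|missed f| + 2 * #|[set [set x; f x] | x in ~: missed f]|.
Proof.
move=> mf; have := @card_moved f setT mf (fun _ _ => in_setT _).
by rewrite setTI setTD cardsT.
Qed.

(* Used when [f a = a]: the partner of [b], if any, becomes a fixed point. *)
Definition rematch f a b : {ffun T -> T} :=
  [ffun x => if x == a then b else if x == b then a else if x == f b then x else f x].

Lemma imatching_rematch f a b : imatching f -> f a = a -> e a b -> imatching (rematch f a b).
Proof.
move=> /imatchingP[ff fe] fa eab.
have nab : a != b by apply: contraTneq eab => ->; rewrite e_irr.
have nba : b == a = false by rewrite eq_sym; apply/negbTE.
apply/imatchingP; split=> x; rewrite !ffunE.
  case: (eqVneq x a) => [->|xa]; first by rewrite nba eqxx.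
  case: (eqVneq x b) => [->|xb]; first by rewrite eqxx.
  case: (eqVneq x (f b)) => [xfb|xfb]; first by rewrite (negbTE xa) (negbTE xb) xfb eqxx.
  have -> : (f x == a) = false by apply: contraNF xa => /eqP H; rewrite -(ff x) H fa.
  have -> : (f x == b) = false by apply: contraNF xfb => /eqP H; rewrite -H ff.
  have -> : (f x == f b) = false by apply: contraNF xb => /eqP H; rewrite -(ff x) H ff.
  by rewrite ff.
case: (eqVneq x a) => [->|xa] //.
case: (eqVneq x b) => [->|xb]; first by rewrite e_sym.
by case: (eqVneq x (f b)) => [->|xfb]; [rewrite eqxx | apply: fe].
Qed.

Lemma missed_rematch f a b : imatching f -> f a = a -> a != b ->
  missed (rematch f a b) = (if f b == b then set0 else [set f b]) :|: (missed f :\ a :\ b).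
Proof.
move=> /imatchingP[ff fe] fa nab; have nba : b == a = false by rewrite eq_sym; apply/negbTE.
apply/setP=> x; rewrite !inE !ffunE.
case: (eqVneq x a) => [->|xa].
  rewrite nba andbF orbF; case: eqP => fb; rewrite !inE //.
  by apply/esym/negbTE; apply: contraNneq nab => afb; rewrite -(ff b) -afb fa.
case: (eqVneq x b) => [->|xb].
  rewrite orbF (negbTE nab); case: eqP => fb; rewrite !inE //.
  by apply/esym/eqP => /esym.
case: (eqVneq x (f b)) => [->|xfb].
  rewrite eqxx; apply/esym.
  by case: (eqVneq (f b) b) => [fb|_]; rewrite !inE ?eqxx //= !fb eqxx.
by case: (eqVneq (f b) b) => [fb|_]; rewrite !inE ?(negbTE xfb).
Qed.

Lemma card_missed_rematch f a b : imatching f -> f a = a -> a != b -> f b != b ->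
  #|missed (rematch f a b)| = #|missed f|.
Proof.
move=> mf fa nab fb; rewrite missed_rematch // (negbTE fb).
have ff := (imatchingP _ mf).1.
have -> : missed f :\ a :\ b = missed f :\ a.
  by apply/setP=> x; rewrite !inE; case: eqVneq => // ->; rewrite (negbTE fb) andbF.
have bf : (b == f b) = false by rewrite eq_sym; apply/negbTE.
by rewrite cardsU1 !inE !ff bf andbF (cardsD1 a (missed f)) !inE fa eqxx.
Qed.

Lemma card_missed_add f a b : imatching f -> f a = a -> a != b -> f b = b ->
  #|missed (rematch f a b)| + 2 = #|missed f|.
Proof.
move=> mf fa nab fb; rewrite missed_rematch // fb eqxx set0U.
rewrite (cardsD1 a (missed f)) (cardsD1 b (missed f :\ a)) !inE fa fb !eqxx eq_sym nab /=.
lia.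
Qed.

Lemma max_imatching_missed2 f a b : max_imatching f -> f a = a -> f b = b -> e a b = false.
Proof.
move=> /max_imatchingP[mf fmax] fa fb; apply/negP=> eab.
have nab : a != b by apply: contraTneq eab => ->; rewrite e_irr.
by have := fmax _ (imatching_rematch mf fa eab); have := card_missed_add mf fa nab fb; lia.
Qed.

Lemma max_imatching_rematch f a b : max_imatching f -> f a = a -> e a b -> max_imatching (rematch f a b).
Proof.
move=> Mf fa eab; have /max_imatchingP[mf fmax] := Mf.
have nab : a != b by apply: contraTneq eab => ->; rewrite e_irr.
have fb : f b != b by apply: contraTneq eab => fb; rewrite (max_imatching_missed2 Mf).
apply/max_imatchingP; split; first exact: imatching_rematch.
by move=> g; rewrite card_missed_rematch //; apply: fmax.
Qed.

(** There is no augmenting path x, z, f z, y: rematching x with z frees f z, so that f z and y would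
    be adjacent vertices missed by a maximum matching. *)
Lemma max_imatching_aug f x y z : max_imatching f -> f x = x -> f y = y -> x != y ->
  e x z -> e y (f z) = false.
Proof.
move=> Mf fx fy nxy exz; apply/negP=> eyz.
have /max_imatchingP[/imatchingP[ff _] _] := Mf.
have fz : f z != z by apply: contraTneq exz => fz; rewrite (max_imatching_missed2 Mf).
have Mg := max_imatching_rematch Mf fx exz.
have yz : y != z by apply: contraNneq fz => <-; rewrite fy.
have yfz : y != f z by apply: contraTneq eyz => <-; rewrite e_irr.
have fzx : f z != x by apply: contraTneq eyz => fzx; rewrite fzx (max_imatching_missed2 Mf).
suff: e y (f z) = false by rewrite eyz.
apply: (max_imatching_missed2 Mg); rewrite ffunE.
  by rewrite [y == x]eq_sym (negbTE nxy) (negbTE yz) (negbTE yfz).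
by rewrite (negbTE fzx) (negbTE fz) eqxx.
Qed.

(* The alternating path of [N] and [N'] from [v] ends in at most one vertex [z] *)
(* missed by [N]; switching [N] along it frees [v] and keeps all other missed   *)
(* vertices.                                                                    *)
Lemma alternating_switch N N' v : max_imatching N -> max_imatching N' -> N' v = v ->
  exists z, forall u, N u = u -> u != z -> exists L, [/\ max_imatching L,
    forall x, N x = N' x -> N x != x -> L x = N x, L u = u & L v = v].
Proof.
move=> MN; have /max_imatchingP[mN _] := MN; have /imatchingP[NN Ne] := mN.
(* Induction on the number of vertices at which [N] and [N'] disagree. *)
move: {2}(#|_|).+1 (ltnSn #|[set x | N x != N' x]|) => k.
elim: k N' v => [//|k IH] N' v ltk MN' N'v.
have /max_imatchingP[mN' _] := MN'; have /imatchingP[NN' Ne'] := mN'.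
have [Nv|Nv] := eqVneq (N v) v.
  by exists v => u Nu _; exists N; split.
set v1 := N v; have ev1 := Ne _ Nv; rewrite -/v1 in Nv ev1.
have Nv1 : N v1 = v by rewrite /v1 NN.
have N'v1 : N' v1 != v1 by apply: contraTneq ev1 => H; rewrite (max_imatching_missed2 MN').
set v2 := N' v1 in N'v1; have N'v2 : N' v2 = v1 by rewrite /v2 NN'.
have v2v : v2 != v by apply: contraNneq Nv => v2v; rewrite -N'v2 v2v N'v.
have e12 : e v1 v2 by apply: Ne'.
have Nv2 : N v2 != v1 by apply: contraNneq v2v => H; rewrite -Nv1 -H NN.
have [Nv2f|Nv2f] := eqVneq (N v2) v2.
  exists v2 => u Nu uv2; exists (rematch N v2 v1); split.
  - by apply: max_imatching_rematch => //; rewrite e_sym.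
  - move=> x; rewrite ffunE Nv1.
    case: (eqVneq x v2) => [->|_]; first by rewrite Nv2f eqxx.
    case: (eqVneq x v1) => [->|_]; first by rewrite Nv1 -/v2 => H; rewrite H eqxx in v2v.
    by case: (eqVneq x v) => [->|//]; rewrite N'v -/v1 => ->; rewrite eqxx.
  - rewrite ffunE Nv1 (negbTE uv2); case: eqVneq => [uv1|_].
      by move: Nu Nv; rewrite uv1 Nv1 => ->; rewrite eqxx.
    by case: eqP.
  - by rewrite ffunE Nv1 [v == v2]eq_sym (negbTE v2v) [v == v1]eq_sym (negbTE Nv) eqxx.
(* Giving [N'] the edge [v v1] of [N] moves its missed vertex to [v2] and removes a disagreement;
   the switched matching obtained for [v2] is afterwards rematched along [v2 v1] to free [v]. *)
have MN2 := max_imatching_rematch MN' N'v ev1; set N2 := rematch N' v v1 in MN2.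
have N2v2 : N2 v2 = v2.
  by rewrite ffunE (negbTE v2v) (negbTE N'v1) eqxx.
have N2E x : x != v -> x != v1 -> x != v2 -> N2 x = N' x.
  by move=> H1 H2 H3; rewrite ffunE (negbTE H1) (negbTE H2) -/v2 (negbTE H3).
have [z Hz] : exists z, forall u, N u = u -> u != z -> exists L, [/\ max_imatching L,
    forall x, N x = N2 x -> N x != x -> L x = N x, L u = u & L v2 = v2].
  apply: IH => //; rewrite ltnS in ltk; apply: leq_trans ltk; apply: proper_card.
  apply/properP; split; last first.
    by exists v; rewrite !inE ?N'v // /N2 ffunE eqxx negbK.
  apply/subsetP=> x; rewrite !inE; apply: contraNneq => NN'x.
  rewrite N2E -?NN'x //.
  + by apply: contraNneq Nv => xv; rewrite /v1 -xv NN'x xv N'v.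
  + by apply: contraNneq v2v => xv1; rewrite -Nv1 -xv1 NN'x xv1.
  by apply: contraNneq Nv2 => xv2; rewrite -xv2 NN'x xv2 N'v2.
exists z => u Nu uz; have [L [ML LN Lu Lv2]] := Hz u Nu uz.
have Lv : L v = v1 by rewrite LN // ffunE eqxx.
have /max_imatchingP[/imatchingP[LL _] _] := ML.
have Lv1 : L v1 = v by rewrite -Lv LL.
exists (rematch L v2 v1); split.
- by apply: max_imatching_rematch => //; rewrite e_sym.
- move=> x NN'x Nx; rewrite ffunE Lv1.
  have xv : x != v by apply: contraNneq Nx => xv; rewrite NN'x xv N'v.
  have xv1 : x != v1 by apply: contraNneq v2v => xv1; rewrite -Nv1 -xv1 NN'x xv1.
  have xv2 : x != v2 by apply: contraNneq Nv2 => xv2; rewrite -xv2 NN'x xv2 N'v2.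
  by rewrite (negbTE xv) (negbTE xv1) (negbTE xv2) LN // N2E.
- rewrite ffunE Lv1.
  have -> : u == v2 = false by apply/negP=> /eqP uv2; rewrite -uv2 Nu eqxx in Nv2f.
  have -> : u == v1 = false.
    by apply/negP=> /eqP uv1; rewrite uv1 Nv1 in Nu; rewrite Nu eqxx in Nv.
  by case: eqP.
- rewrite ffunE Lv1 [v == v2]eq_sym (negbTE v2v) [v == v1]eq_sym (negbTE Nv).
  by rewrite eqxx.
Qed.

(** Vertices that no maximum matching misses together. Among vertices missed by some maximum
    matching this is an equivalence relation, whose classes serve as the blocks of the barrier. *)
Definition comiss u v := (u == v) || [forall f, max_imatching f ==> ~~ ((f u == u) && (f v == v))].

Lemma comiss_contra u v f : comiss u v -> u != v -> max_imatching f -> f u = u -> f v = v -> False.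
Proof.
move=> /orP[->//|/forallP/(_ f)/implyP H] _ /H /negP + fu fv.
by rewrite fu fv !eqxx; apply.
Qed.

Lemma comiss_sym : symmetric comiss.
Proof.
move=> u v; rewrite /comiss eq_sym; congr orb.
by apply: eq_forallb => f; rewrite andbC.
Qed.

(* Gallai's lemma. *)
Lemma comiss_trans u v w : (exists2 f, max_imatching f & f v = v) ->
  comiss u v -> comiss v w -> comiss u w.
Proof.
move=> [N' MN' N'v] uv vw.
have [->//|nuv] := eqVneq u v; have [<-//|nvw] := eqVneq v w.
have [->|nuw] := eqVneq u w; first by rewrite /comiss eqxx.
apply/orP; right; apply/forallP=> N; apply/implyP=> MN; apply/negP=> /andP[/eqP Nu /eqP Nw].
have [z Hz] := alternating_switch MN MN' N'v.
have [uz|uz] := eqVneq u z.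
  have wz : w != z by rewrite -uz eq_sym.
  by have [L [ML _ Lw Lv]] := Hz w Nw wz; exact: comiss_contra vw nvw ML Lv Lw.
by have [L [ML _ Lu Lv]] := Hz u Nu uz; exact: comiss_contra uv nuv ML Lu Lv.
Qed.

Lemma comiss_adj u v : e u v -> comiss u v.
Proof.
move=> euv; apply/orP; right; apply/forallP=> f; apply/implyP=> Mf.
apply/negP=> /andP[/eqP fu /eqP fv].
by have := max_imatching_missed2 Mf fu fv; rewrite euv.
Qed.

End Matchings.

Section Barrier.
Variables (T : finType) (e : rel T).
Hypothesis (e_sym : symmetric e) (e_irr : irreflexive e).

Definition induced (S : {set T}) : rel T := [rel x y | [&& x \in S, y \in S & e x y]].

Lemma induced_sym S : symmetric (induced S).
Proof. by move=> x y; rewrite /induced /= e_sym andbCA. Qed.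

Lemma induced_irr S : irreflexive (induced S).
Proof. by move=> x; rewrite /induced /= e_irr !andbF. Qed.

(** Adjacent vertices are never missed together, so edges stay inside classes of [comiss], and a
    maximum matching misses at most one vertex of each class. One missing a given vertex of K pairs
    up the rest of K, hence |K| is odd. *)
Lemma barrier_no_essential (S : {set T}) :
  (forall x, x \in S -> exists2 f, max_imatching (induced S) f & f x = x) ->
  exists P : {set {set T}}, [/\ partition P S,
    forall x y, x \in S -> y \in S -> e x y -> exists2 K, K \in P & (x \in K) && (y \in K),
    forall K, K \in P -> odd #|K|
    & exists2 f, imatching (induced S) f & 2 * (\sum_(K in P) #|K|./2) + #|missed f| <= #|T|].
Proof.
move=> ness.
have eqR : {in S & &, equivalence_rel (comiss (induced S))}.
  move=> x y z xS yS zS; split; first by rewrite /comiss eqxx.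
  move=> xy; apply/idP/idP => H.
    by apply: (comiss_trans (@induced_sym S) (@induced_irr S) (ness _ xS)) H; rewrite comiss_sym.
  exact: (comiss_trans (@induced_sym S) (@induced_irr S) (ness _ yS)) xy H.
set P := equivalence_partition (comiss (induced S)) S.
have pP : partition P S := equivalence_partitionP eqR.
have memP x y : x \in S -> y \in S -> (y \in pblock P x) = comiss (induced S) x y.
  exact: pblock_equivalence_partition.
have adjP x y : x \in S -> y \in S -> e x y -> pblock P x = pblock P y.
  move=> xS yS exy; apply: same_pblock; first by case/and3P: pP.
  rewrite memP //; apply: comiss_adj; [exact: induced_sym | exact: induced_irr |].
  by rewrite /induced /= xS yS e_sym.
have KP K x : K \in P -> x \in K -> x \in S /\ K = pblock P x.
  move=> KinP xK; split; first by rewrite -(cover_partition pP); apply/bigcupP; exists K.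
  by rewrite (def_pblock _ KinP xK) //; case/and3P: pP.
have fixP f K : max_imatching (induced S) f -> K \in P -> #|K :&: missed f| <= 1.
  move=> Mf KinP; apply/card_le1_eqP => x y; rewrite !inE => /andP[xK /eqP fx] /andP[yK /eqP fy].
  apply/eqP; apply: contraT => nxy.
  have [xS Kx] := KP _ _ KinP xK; have [yS _] := KP _ _ KinP yK.
  have cxy : comiss (induced S) x y by rewrite -memP // -Kx.
  by rewrite eq_sym in nxy; case: (comiss_contra cxy nxy Mf fx fy).
have stabP f K : imatching (induced S) f -> K \in P -> forall x, x \in K -> f x \in K.
  move=> /imatchingP[ff fe] KinP x xK; have [->//|fx] := eqVneq (f x) x.
  have [xS Kx] := KP _ _ KinP xK; have := fe _ fx; rewrite /induced /= => /and3P[_ fxS exf].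
  by rewrite Kx (adjP _ _ xS fxS exf) mem_pblock (cover_partition pP).
exists P; split=> //.
  move=> x y xS yS exy; exists (pblock P x); first by rewrite pblock_mem ?(cover_partition pP).
  by rewrite {2}(adjP x y) // !mem_pblock (cover_partition pP) xS yS.
  move=> K KinP; have [x xK] : exists x, x \in K.
    by apply/set0Pn; apply: contraTneq KinP => ->; case/and3P: pP.
  have [xS Kx] := KP _ _ KinP xK; have [f Mf fx] := ness x xS.
  have [mf _] := max_imatchingP _ _ Mf.
  rewrite (card_moved mf (stabP f K mf KinP)) oddD mul2n odd_double addbF.
  have := fixP f K Mf KinP.
  have : 0 < #|K :&: missed f| by apply/card_gt0P; exists x; rewrite !inE xK fx eqxx.
  by case: #|_| => [|[|]].
have [f Mf _] := max_imatching_exists (imatching_id (induced S)).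
have [mf _] := max_imatchingP _ _ Mf; exists f => //.
have cardT : #|T| = #|~: S| + #|S| by rewrite addnC cardsC.
rewrite cardT (card_partition pP).
rewrite -(cardsID S (missed f)) [missed f :&: S]setIC.
have : #|missed f :\: S| <= #|~: S|.
  by apply: subset_leq_card; apply/subsetP=> x; rewrite !inE => /andP[].
have <- : \sum_(K in P) #|K :&: missed f| = #|S :&: missed f|.
  rewrite -sum1_card (eq_bigl (fun x => (x \in S) && (x \in missed f))); last first.
    by move=> x; rewrite inE.
  rewrite (set_partition_big_cond _ pP).
  by apply: eq_bigr => K _; rewrite -sum1_card; apply: eq_bigl => x; rewrite inE.
have : 2 * (\sum_(K in P) #|K|./2) + \sum_(K in P) #|K :&: missed f| <= \sum_(K in P) #|K|.
  rewrite big_distrr /= -big_split /=; apply: leq_sum => K KinP.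
  have := fixP f K Mf KinP; have := card_moved mf (stabP f K mf KinP); lia.
by move=> H1 H2; rewrite addnA addnC; apply: leq_add.
Qed.

Lemma imatching_inducedS (S S' : {set T}) f : S \subset S' -> imatching (induced S) f -> imatching (induced S') f.
Proof.
move=> /subsetP SS' /imatchingP[ff fe]; apply/imatchingP; split=> // x /fe.
by rewrite /induced /= => /and3P[/SS'-> /SS'-> ->].
Qed.

(* The Tutte-Berge formula: essential vertices are moved into [A] one by one, and *)
(* when none is left the classes of [comiss] are the blocks.                      *)
Lemma barrier (S : {set T}) :
  exists A : {set T}, exists P : {set {set T}}, [/\ A \subset S, partition P (S :\: A),
    forall x y, x \in S :\: A -> y \in S :\: A -> e x y ->
      exists2 K, K \in P & (x \in K) && (y \in K),
    forall K, K \in P -> odd #|K|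
    & exists2 f, imatching (induced S) f &
        2 * (#|A| + \sum_(K in P) #|K|./2) + #|missed f| <= #|T|].
Proof.
move: {2}(#|S|).+1 (ltnSn #|S|) => k; elim: k S => [//|k IH] S ltSk.
have [ess|] := boolP [exists x in S, [forall f, max_imatching (induced S) f ==> (f x != x)]]; last first.
  rewrite negb_exists_in => /forall_inP ness.
  have [x xS|P [pP eP oP fP]] := barrier_no_essential (S := S).
    have := ness x xS; rewrite negb_forall => /existsP[f].
    by rewrite negb_imply negbK => /andP[Mf /eqP fx]; exists f.
  exists set0, P; rewrite sub0set setD0; split=> //.
  by rewrite cards0.
case/exists_inP: ess => x xS /forallP ess.
have [|A [P [AS pP eP oP [f mf szf]]]] := IH (S :\ x).
  by move: ltSk; rewrite (cardsD1 x S) xS.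
have SD : S :\ x :\: A = S :\: (x |: A).
  by apply/setP=> y; rewrite !inE negb_or; case: (y == x) (y \in A) => [] [].
have xA : x \notin A by apply/negP=> /(subsetP AS); rewrite !inE eqxx.
rewrite SD in pP eP; exists (x |: A), P; split=> //.
  by rewrite subUset sub1set xS (subset_trans AS) ?subsetDl.
have mSf : imatching (induced S) f by apply: imatching_inducedS mf; apply: subsetDl.
have [g Mg gf] := max_imatching_exists mSf; have [mg gmin] := max_imatchingP _ _ Mg; exists g => //.
have fx : f x = x.
  apply/eqP; apply: contraT; have [_ H] := imatchingP _ _ mf.
  by move/H; rewrite /induced /= !inE eqxx.
(* As [x] is essential, [f], which misses [x], is not maximum in S. By parity [g] misses at least
   two vertices fewer, which pays for putting [x] into the barrier. *)
have : #|missed g| != #|missed f|.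
  apply/negP=> /eqP gfE; have /implyP := ess f; rewrite fx eqxx => H.
  apply/notF/H/max_imatchingP; split=> // h mh; rewrite -gfE; exact: gmin.
have := card_imatching mg; have := card_imatching mf; rewrite cardsU1 xA; lia.
Qed.

End Barrier.

(** * Degree conditions for saturating matchings *)

Section Saturation.
Variables (T : finType) (e : rel T).
Hypothesis (e_sym : symmetric e) (e_irr : irreflexive e).

(** Ore's argument. By parity a missed vertex x of S comes with a second one y; by
    [max_imatching_aug] the neighbours of x and the partners of the neighbours of y are disjoint
    subsets of S without x and y, so the two degrees add up to at most |S| - 2. *)
Lemma ore_perfect_matching (S : {set T}) : ~~ odd #|S| ->
  {in S &, forall x y, x != y ->
     #|S| <= #|[set z in S | e x z]| + #|[set z in S | e y z]| + 1} ->
  exists2 f, imatching (induced e S) f & forall x, x \in S -> f x != x.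
Proof.
move=> oddS degS; have [f Mf _] := max_imatching_exists (imatching_id (induced e S)).
have [mf _] := max_imatchingP _ _ Mf; have [ff fe] := imatchingP _ _ mf.
exists f => // x xS; apply: contraT; rewrite negbK => /eqP fx.
have rS := induced_sym e_sym S; have rI := induced_irr e_irr S.
have stab z : z \in S -> f z \in S.
  by move=> zS; have [->//|/fe] := eqVneq (f z) z; case/and3P.
have [y yS /andP[yx /eqP fy]] : exists2 y, y \in S & (y != x) && (f y == y).
  have := card_moved mf stab; rewrite (cardsD1 x (S :&: _)) !inE xS fx eqxx /=.
  have [->|[y]] := set_0Vmem ((S :&: missed f) :\ x).
    by rewrite cards0 addn0 add1n => H; move: oddS; rewrite H /= mul2n odd_double.
  by rewrite !inE => /and3P[yx yS fy] _; exists y => //; rewrite yx.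
have := degS x y xS yS; rewrite eq_sym yx => /(_ isT).
set X := [set z in S | e x z]; set Y := [set z in S | e y z].
have dXY : [disjoint X & f @: Y].
  apply/pred0P=> z /=; apply/negP=> /andP[]; rewrite !inE => /andP[zS exz].
  case/imsetP=> w; rewrite inE => /andP[wS eyw] zw.
  have xy : x != y by rewrite eq_sym.
  have := @max_imatching_aug _ (induced e S) rS rI f x y z Mf fx fy xy.
  rewrite /induced /= xS zS exz => /(_ isT); rewrite zw ff yS wS eyw => H; by [].
have : #|X| + #|f @: Y| <= #|S :\ x :\ y|.
  have /eqP <- : #|X :|: f @: Y| == #|X| + #|f @: Y| by rewrite (leq_card_setU _ _).2.
  apply: subset_leq_card; apply/subsetP => z; rewrite !inE => /orP[/andP[zS exz]|].
    rewrite zS andbT; apply/andP; split.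
      apply/negP=> /eqP zy; have := max_imatching_missed2 rS rI Mf fx fy.
      by rewrite /induced /= xS yS -zy exz.
    by apply/negP=> /eqP zx; rewrite zx e_irr in exz.
  case/imsetP=> w; rewrite inE => /andP[wS eyw] ->; rewrite stab // andbT.
  apply/andP; split; apply/negP=> /eqP H.
    by move: eyw; rewrite -(ff w) H fy e_irr.
  have := max_imatching_missed2 rS rI Mf fy fx; rewrite /induced /= xS yS.
  by move: eyw; rewrite -(ff w) H fx => ->.
have inj : injective f by apply: (can_inj ff).
rewrite card_imset // (cardsD1 x S) xS (cardsD1 y (S :\ x)) !inE yx yS /=; lia.
Qed.

End Saturation.

Section Bipartite.
Variables (T : finType) (r : rel T) (A Z : {set T}).
Hypothesis (r_sym : symmetric r) (dAZ : [disjoint A & Z]).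

Definition bipartite : rel T :=
  [rel x y | r x y && ((x \in A) && (y \in Z) || (y \in A) && (x \in Z))].

Lemma bipartite_sym : symmetric bipartite.
Proof. by move=> x y; rewrite /bipartite /= r_sym orbC. Qed.

Lemma bipartite_irr : irreflexive bipartite.
Proof.
move=> x; rewrite /bipartite /= orbb; case xA: (x \in A); rewrite ?andbF //=.
by rewrite (disjointFr dAZ xA) andbF.
Qed.

(** If a maximum matching misses x in A, let p be the number of neighbours of x in Z. Each of their
    p partners in A is non-adjacent to every unmatched vertex of Z, of which there are at least |Z|
    + 1 - |A|; x itself has |Z| - p non-neighbours. *)
Lemma bipartite_saturate :
  (exists2 f, imatching bipartite f & forall x, x \in A -> f x != x) \/
  exists2 x, x \in A & exists p,
    p + #|[set z in Z | ~~ r x z]| = #|Z| /\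
    #|Z| + p * (#|Z| + 1 - #|A|) <= p + \sum_(y in A) #|[set z in Z | ~~ r y z]|.
Proof.
have bS := bipartite_sym; have bI := bipartite_irr.
have [f Mf _] := max_imatching_exists (imatching_id bipartite).
have [mf _] := max_imatchingP _ _ Mf; have [ff fe] := imatchingP _ _ mf.
have inj : injective f by apply: (can_inj ff).
have [/forall_inP H|] := boolP [forall x in A, f x != x]; first by left; exists f.
rewrite negb_forall_in => /exists_inP[x xA]; rewrite negbK => /eqP fx; right.
exists x => //; exists #|[set z in Z | r x z]|.
set N := [set z in Z | r x z]; set M := [set z in Z | ~~ r x z].
have ZE : #|N| + #|M| = #|Z|.
  rewrite -(cardsID [set z | r x z] Z); congr (_ + _); apply: eq_card => z; rewrite /N /M !inE //.
  by rewrite andbC.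
split=> //; set U := [set z in Z | f z == z].
have mvZ z : z \in Z -> f z != z -> f z \in A :\ x.
  move=> zZ fz; have := fe _ fz; rewrite /bipartite /= (disjointFl dAZ zZ) /= => /and3P[_ fzA _].
  rewrite !inE fzA andbT; apply: contraNneq fz => H.
  by rewrite H -(ff z) H fx.
have cU : #|Z| + 1 <= #|A| + #|U|.
  have -> : #|A| = #|A :\ x|.+1 by rewrite (cardsD1 x A) xA.
  suff : #|Z :\: U| <= #|A :\ x|.
    have := cardsID U Z; have : #|Z :&: U| = #|U|.
      by apply: eq_card => z; rewrite !inE; case: (z \in Z).
    lia.
  rewrite -(card_imset _ inj); apply: subset_leq_card; apply/subsetP => _ /imsetP[z + ->].
  by rewrite !inE negb_and => /andP[+ zZ]; rewrite zZ /= => fz; have := mvZ z zZ fz; rewrite !inE.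
have NA z : z \in N -> f z != z.
  rewrite inE => /andP[zZ rxz]; apply/negP=> /eqP fz.
  by have := max_imatching_missed2 bS bI Mf fx fz; rewrite /bipartite /= rxz xA zZ.
have sub : f @: N \subset A :\ x.
  apply/subsetP=> _ /imsetP[z zN ->]; apply: mvZ; last exact: NA.
  by move: zN; rewrite inE => /andP[].
have misU y : y \in f @: N -> #|U| <= #|[set z in Z | ~~ r y z]|.
  case/imsetP=> z zN ->; apply: subset_leq_card; apply/subsetP => w.
  rewrite !inE => /andP[wZ /eqP fw]; rewrite wZ /=; apply/negP=> rzw.
  have zZ : z \in Z by move: zN; rewrite inE => /andP[].
  have xw : x != w by apply: contraTneq xA => ->; rewrite (disjointFl dAZ wZ).
  have := @max_imatching_aug _ bipartite bS bI f x w z Mf fx fw xw.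
  have /setD1P[_ fzA] := mvZ z zZ (NA z zN).
  rewrite r_sym in rzw; rewrite /bipartite /= xA zZ fzA wZ rzw /= !orbT /=.
  have -> : r x z by move: zN; rewrite inE => /andP[].
  by move/(_ isT).
rewrite (bigD1 x) //= -/M.
have : \sum_(y in f @: N) #|U| <= \sum_(y in A | y != x) #|[set z in Z | ~~ r y z]|.
  apply: (@leq_trans (\sum_(y in f @: N) #|[set z in Z | ~~ r y z]|)).
    exact: leq_sum.
  rewrite [X in _ <= X](bigID (mem (f @: N))) /=.
  rewrite [X in _ <= X + _](eq_bigl [in f @: N]); first exact: leq_addr.
  move=> y; rewrite andbC; case yN: (y \in f @: N) => //=.
  by have := subsetP sub _ yN; rewrite !inE andbC.
rewrite sum_nat_const card_imset //.
have : #|N| * (#|Z| + 1 - #|A|) <= #|N| * #|U| by rewrite leq_mul2l; apply/orP; right; lia.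
lia.
Qed.

End Bipartite.

(** * Rainbow matchings *)

Section Rainbow.
Variables (T : finType) (C : eqType) (c : {set T} -> C).
Implicit Types (M E : {set {set T}}).

Definition rainbow_set M := [/\ forall e, e \in M -> #|e| = 2, trivIset M & {in M &, injective c}].

Lemma rainbow_set_sub M M' : M' \subset M -> rainbow_set M -> rainbow_set M'.
Proof.
move=> sub [H1 H2 H3]; split; first by move=> e /(subsetP sub)/H1.
  exact: trivIsetS H2.
by move=> x y /(subsetP sub) xM /(subsetP sub) yM; apply: H3.
Qed.

Lemma rainbow_set_add M (e : {set T}) : rainbow_set M -> #|e| = 2 -> [disjoint e & cover M] ->
  (forall e', e' \in M -> c e' != c e) -> rainbow_set (e |: M) /\ #|e |: M| = #|M|.+1.
Proof.
move=> [H1 H2 H3] ce de cole.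
have eM : e \notin M by apply/negP => /cole; rewrite eqxx.
split; last by rewrite cardsU1 eM.
split.
- by move=> e'; rewrite !inE => /orP[/eqP->|/H1].
- have dis e' : e' \in M -> [disjoint e & e'].
    move=> e'M; apply: disjointWr de.
    exact: (bigcup_max e').
  apply/trivIsetP => x y; rewrite !inE => /orP[/eqP->|xM] /orP[/eqP->|yM]; rewrite ?eqxx //.
  + by move=> _; apply: dis.
  + by move=> _; rewrite disjoint_sym; apply: dis.
  by move: x y xM yM; apply/trivIsetP.
- move=> x y; rewrite !inE => /orP[/eqP->|xM] /orP[/eqP->|yM] //.
  + by move=> H; have := cole _ yM; rewrite H eqxx.
  + by move=> H; have := cole _ xM; rewrite H eqxx.
  exact: H3.
Qed.

Lemma cover_add M (e : {set T}) : cover (e |: M) = e :|: cover M.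
Proof.
by rewrite /cover; case: (boolP (e \in M)) => eM;
  [rewrite (setUidPr _) ?sub1set // (setUidPr _) //; apply: (bigcup_max e) | rewrite big_setU1].
Qed.

Lemma rainbow_set_of_imatching E (r : rel T) f : (forall e, e \in E -> #|e| = 2) -> {in E &, injective c} ->
  (forall x y, r x y -> [set x; y] \in E) -> imatching r f ->
  exists2 M, rainbow_set M /\ M \subset E &
    cover M = ~: missed f /\ 2 * #|M| = #|~: missed f|.
Proof.
move=> E2 Einj rE /imatchingP[ff fe].
have [|t1 t2 t3] := @card_pairs T f (~: missed f).
  by move=> x; rewrite !inE => fx; rewrite ff eq_sym.
exists [set [set x; f x] | x in ~: missed f]; last by [].
have sub : [set [set x; f x] | x in ~: missed f] \subset E.
  by apply/subsetP=> _ /imsetP[x + ->]; rewrite !inE => /fe/rE.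
split=> //; split=> //; first by move=> e /(subsetP sub)/E2.
by move=> x y /(subsetP sub) xE /(subsetP sub) yE; apply: Einj.
Qed.

End Rainbow.

Lemma disjoint_setUl (T : finType) (A B D : {set T}) :
  [disjoint A :|: B & D] = [disjoint A & D] && [disjoint B & D].
Proof. by rewrite -!setI_eq0 setIUl setU_eq0. Qed.

Lemma disjoint_setUr (T : finType) (A B D : {set T}) :
  [disjoint D & A :|: B] = [disjoint D & A] && [disjoint D & B].
Proof. by rewrite disjoint_sym disjoint_setUl ![[disjoint D & _]]disjoint_sym. Qed.

Lemma exists_pair (T : finType) (U : {set T}) : 2 <= #|U| -> exists2 e : {set T}, #|e| = 2 & e \subset U.
Proof.
move=> /card_gt1P[x [y [xU yU xy]]]; exists [set x; y]; first by rewrite cards2 xy.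
by rewrite subUset !sub1set xU.
Qed.

Lemma eq_set2 (T : finType) (e : {set T}) x y : #|e| = 2 -> x \in e -> y \in e -> x != y -> e = [set x; y].
Proof.
move=> ce xe ye xy; apply/esym/eqP; rewrite eqEcard ce cards2 xy andbT.
by rewrite subUset !sub1set xe.
Qed.

Lemma pair_other (T : finType) (e : {set T}) x : #|e| = 2 -> x \in e -> exists2 y, x != y & e = [set x; y].
Proof.
move=> ce xe; have : 0 < #|e :\ x| by have := cardsD1 x e; rewrite ce xe; lia.
case/card_gt0P=> y; rewrite !inE => /andP[yx ye]; exists y; first by rewrite eq_sym.
by apply: eq_set2 => //; rewrite eq_sym.
Qed.

Section Extend.
Variables (T : finType) (C : eqType) (c : {set T} -> C).
Implicit Types (M N E : {set {set T}}) (e f g X U : {set T}).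

Lemma rainbow_set_union M N : rainbow_set c M -> rainbow_set c N -> [disjoint cover M & cover N] ->
  (forall e f, e \in M -> f \in N -> c e != c f) ->
  rainbow_set c (M :|: N) /\ #|M :|: N| = #|M| + #|N|.
Proof.
move=> [M2 tM iM] [N2 tN iN] dMN cMN.
have dis e f : e \in M -> f \in N -> [disjoint e & f].
  by move=> eM fN; apply: disjointW dMN; [exact: (bigcup_max e) | exact: (bigcup_max f)].
split; last first.
  apply/eqP; rewrite (leq_card_setU _ _).2; apply/pred0P=> e /=.
  by apply/negP=> /andP[eM eN]; have := cMN _ _ eM eN; rewrite eqxx.
split.
- by move=> e; rewrite inE => /orP[/M2|/N2].
- apply/trivIsetP => e f; rewrite !inE => /orP[eM|eN] /orP[fM|fN].
  + by move: e f eM fM; apply/trivIsetP.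
  + by move=> _; apply: dis.
  + by move=> _; rewrite disjoint_sym; apply: dis.
  + by move: e f eN fN; apply/trivIsetP.
move=> e f; rewrite !inE => /orP[eM|eN] /orP[fM|fN]; first exact: iM.
- by move=> H; have := cMN _ _ eM fN; rewrite H eqxx.
- by move=> H; have := cMN _ _ fM eN; rewrite H eqxx.
exact: iN.
Qed.

Lemma rainbow_set_single e : #|e| = 2 -> [/\ rainbow_set c [set e], #|[set e]| = 1 & cover [set e] = e].
Proof.
move=> ce; split; [|exact: cards1 | exact: cover1].
split=> [f||f1 f2]; rewrite ?inE; first by move/eqP->.
  by apply/trivIsetP => f1 f2 /set1P-> /set1P->; rewrite eqxx.
by move=> /eqP-> /eqP->.
Qed.

Lemma rainbow_set_pair e f : #|e| = 2 -> #|f| = 2 -> [disjoint e & f] -> c e != c f ->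
  [/\ rainbow_set c [set e; f], #|[set e; f]| = 2 & cover [set e; f] = e :|: f].
Proof.
move=> ce cf def col.
have [Re c1e coe] := rainbow_set_single ce; have [Rf c1f cof] := rainbow_set_single cf.
have [||R ->] := rainbow_set_union Re Rf.
- by rewrite coe cof.
- by move=> ? ? /set1P-> /set1P->.
by rewrite c1e c1f cover_add cof.
Qed.

Lemma rainbow_set_triple e f g : #|e| = 2 -> #|f| = 2 -> #|g| = 2 ->
  [disjoint e & f] -> [disjoint e & g] -> [disjoint f & g] ->
  c e != c f -> c e != c g -> c f != c g ->
  [/\ rainbow_set c (e |: [set f; g]), #|e |: [set f; g]| = 3
    & cover (e |: [set f; g]) = e :|: (f :|: g)].
Proof.
move=> ce cf cg ef eg fg nef neg nfg.
have [Re c1e coe] := rainbow_set_single ce; have [Rf c1f cof] := rainbow_set_pair cf cg fg nfg.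
have [||R ->] := rainbow_set_union Re Rf.
- by rewrite coe cof disjoint_setUr ef.
- by move=> ? ? /set1P-> /set2P[->|->].
by rewrite c1e c1f cover_add cof.
Qed.

(* Some colour [b] is so frequent that any four vertices can be avoided by an edge   *)
(* coloured [b]; hence disjoint edges of other colours have equal colours, and edges *)
(* representing four such colours form a star.                                       *)
Lemma no_rainbow3_star U E : 14 <= #|U| ->
  (forall M, rainbow_set c M -> cover M \subset U -> #|M| <= 2) ->
  (forall e, e \in E -> #|e| = 2 /\ e \subset U) -> {in E &, injective c} -> 5 <= #|E| ->
  exists2 x, x \in U & exists b, forall e, #|e| = 2 -> e \subset U :\ x -> c e = b.
Proof.
move=> cU no3 E2 Einj cE.
have no3' e f g : #|e| = 2 -> #|f| = 2 -> #|g| = 2 ->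
  e \subset U -> f \subset U -> g \subset U ->
  [disjoint e & f] -> [disjoint e & g] -> [disjoint f & g] ->
  c e != c f -> c e != c g -> c f != c g -> False.
  move=> ce cf cg eU fU gU ef eg fg nef neg nfg.
  have [R c3 co] := rainbow_set_triple ce cf cg ef eg fg nef neg nfg.
  by have := no3 _ R; rewrite co !subUset eU fU gU c3 => /(_ isT).
have cU2 e f : #|e| = 2 -> #|f| = 2 -> #|e :|: f| <= 4.
  by move=> ce cf; rewrite cardsU ce cf leq_subr.
have cD (W X : {set T}) : #|W| - #|X| <= #|W :\: X|.
  by rewrite cardsD leq_sub2l // subset_leq_card // subsetIr.
have [b popb] : exists b, forall X, #|X| <= 4 -> exists e, [/\ #|e| = 2, e \subset U :\: X & c e = b].
  have [/existsP[f1 /existsP[f2 /and5P[/eqP c1 /eqP c2 u1 u2 /andP[d12 n12]]]]|same] :=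
    boolP [exists f1 : {set T}, exists f2 : {set T},
    [&& #|f1| == 2, #|f2| == 2, f1 \subset U, f2 \subset U & [disjoint f1 & f2] && (c f1 != c f2)]].
    set Z := U :\: (f1 :|: f2).
    have cZ : 10 <= #|Z| by have := cD U (f1 :|: f2); have := cU2 _ _ c1 c2; rewrite -/Z; lia.
    have ZU : Z \subset U by apply: subsetDl.
    have colZ e : #|e| = 2 -> e \subset Z -> c e != c f1 -> c e = c f2.
      move=> ce eZ n1; apply/eqP/negPn/negP=> n2; have eU := subset_trans eZ ZU.
      have : [disjoint e & f1 :|: f2].
        by move: eZ; rewrite /Z setDE subsetI -disjoints_subset => /andP[].
      by rewrite disjoint_setUr => /andP[d1 d2]; apply: (no3' e f1 f2).
    have [/forallP pop1|] := boolP [forall X : {set T}, (#|X| <= 4) ==>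
        [exists e : {set T}, [&& #|e| == 2, e \subset Z :\: X & c e == c f1]]].
      exists (c f1) => X cX; have /implyP/(_ cX)/existsP[e /and3P[/eqP ce eZ /eqP col]] := pop1 X.
      by exists e; split=> //; apply: subset_trans eZ _; apply: setSD.
    (* Otherwise every edge inside Z minus [X1] has the colour of [f2]. Removing X as well still
       leaves 14 - 4 - 4 - 4 = 2 vertices, enough for an edge. *)
    rewrite negb_forall => /existsP[X1]; rewrite negb_imply negb_exists => /andP[cX1 /forallP non1].
    exists (c f2) => X cX; have [|e ce eZ] := @exists_pair _ (Z :\: X1 :\: X).
      by have := cD Z X1; have := cD (Z :\: X1) X; lia.
    have eZ1 := subset_trans eZ (subsetDl _ _).
    exists e; split=> //.
      by apply: subset_trans eZ _; apply: setSD; apply: subset_trans (subsetDl _ _) ZU.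
    apply: colZ => //; first exact: subset_trans eZ1 (subsetDl _ _).
    by have := non1 e; rewrite ce eqxx eZ1.
  (* Here disjoint edges in U always agree in colour, so an edge disjoint from [f1] and [f2] would
     give these two representatives the same colour. *)
  have /card_gt1P[f1 [f2 [f1E f2E n12]]] : 1 < #|E| by lia.
  have [c1 u1] := E2 _ f1E; have [c2 u2] := E2 _ f2E.
  have [|e ce eU] := @exists_pair _ (U :\: (f1 :|: f2)).
    by have := cD U (f1 :|: f2); have := cU2 _ _ c1 c2; lia.
  move: eU; rewrite setDE subsetI -disjoints_subset disjoint_setUr => /and3P[eU d1 d2].
  have H f : #|f| = 2 -> f \subset U -> [disjoint e & f] -> c e = c f.
    move=> cf fU d; apply/eqP; apply: contraNT same => n.
    by apply/existsP; exists e; apply/existsP; exists f; rewrite ce cf eU fU d n.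
  by case/eqP: n12; apply: Einj => //; rewrite -(H f1) // -(H f2).
have step2 e f : #|e| = 2 -> #|f| = 2 -> e \subset U -> f \subset U -> [disjoint e & f] ->
    c e != b -> c f != b -> c e = c f.
  move=> ce cf eU fU ef eb fb; apply/eqP; apply: contraT => nef.
  have [g [cg gU gb]] := popb _ (cU2 _ _ ce cf).
  move: gU; rewrite setDE subsetI -disjoints_subset disjoint_setUr => /and3P[gU d1 d2].
  by case: (@no3' g e f) => //; rewrite gb eq_sym.
set F := [set e in E | c e != b].
have cF : 4 <= #|F|.
  have : #|E :\: F| <= 1.
    apply/card_le1_eqP => e f; rewrite !inE !negb_and !negbK.
    move=> /andP[+ eE] /andP[+ fE]; rewrite eE fE /= => /eqP eb /eqP fb.
    by apply: Einj => //; rewrite eb fb.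
  have EF : E :&: F = F by apply/setP => e; rewrite !inE; case: (e \in E).
  move=> c1; rewrite -(leq_add2r 1); apply: leq_trans (leq_add (leqnn _) c1).
  by rewrite -{1}EF cardsID.
have FP e : e \in F -> [/\ e \in E, #|e| = 2, e \subset U & c e != b].
  by rewrite inE => /andP[eE eb]; have [] := E2 _ eE.
have meet e f : e \in F -> f \in F -> ~~ [disjoint e & f].
  move=> eF fF; apply/negP=> d.
  have [eE ce eU eb] := FP _ eF; have [fE cf fU fb] := FP _ fF.
  have H : e = f by apply: Einj => //; apply: step2.
  by move: d; rewrite -H -setI_eq0 setIid => /eqP e0; rewrite e0 cards0 in ce.
have pick (X : {set {set T}}) : #|X| <= 3 -> exists2 f, f \in F & f \notin X.
  move=> cX; have : 0 < #|F :\: X|.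
    by rewrite cardsD; have := subset_leq_card (subsetIr F X); lia.
  by case/card_gt0P=> f; rewrite inE => /andP[]; exists f.
have meetx e f x : e \in F -> f \in F -> x \in e -> x \notin f -> exists y, [/\ y \in f, e = [set x; y] & x != y].
  move=> eF fF xe xf; have := meet _ _ eF fF; rewrite -setI_eq0 => /set0Pn[y]; rewrite inE => /andP[ye yf].
  have xy : x != y by apply: contraNneq xf => ->.
  by exists y; split=> //; apply: eq_set2; have [] := FP _ eF.
have [f1 f1F _] : exists2 f, f \in F & f \notin set0 by apply: pick; rewrite cards0.
have [f2 f2F] : exists2 f, f \in F & f \notin [set f1] by apply: pick; rewrite cards1.
rewrite inE => f21.
have [x xf1 xf2] : exists2 x, x \in f1 & x \in f2.
  by have := meet _ _ f1F f2F; rewrite -setI_eq0 => /set0Pn[x]; rewrite inE => /andP[]; exists x.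
have [_ cf1 uf1 _] := FP _ f1F; have [_ cf2 uf2 _] := FP _ f2F.
have [y xy f1E] := pair_other cf1 xf1; have [z xz f2E] := pair_other cf2 xf2.
have yz : y != z by apply: contraNneq f21 => yz; rewrite f1E f2E yz.
have star f : f \in F -> x \in f.
  move=> fF; apply: contraT => xf; have [_ cf _ _] := FP _ fF.
  have fE : f = [set y; z].
    have [y' [y'f e1 _]] := meetx _ _ _ f1F fF xf1 xf; have [z' [z'f e2 _]] := meetx _ _ _ f2F fF xf2 xf.
    have yf : y \in f.
      by have : y \in [set x; y'] by [rewrite -e1 f1E !inE eqxx orbT]; rewrite !inE eq_sym (negbTE xy) => /eqP->.
    have zf : z \in f.
      by have : z \in [set x; z'] by [rewrite -e2 f2E !inE eqxx orbT]; rewrite !inE eq_sym (negbTE xz) => /eqP->.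
    exact: eq_set2.
  (* The edges [f1], [f2], [f] form a triangle, and a fourth edge cannot meet all three sides. *)
  have [g gF] : exists2 g, g \in F & g \notin [set f1; f2; f].
    by apply: pick; rewrite (leq_trans (leq_card_setU _ _).1) // cards1 cards2; case: eqP.
  rewrite !inE !negb_or => /andP[/andP[g1 g2] g3]; have [_ cg _ _] := FP _ gF.
  have [xg|xg] := boolP (x \in g).
    have [w [wf gE _]] := meetx _ _ _ gF fF xg xf.
    by move: wf; rewrite fE !inE => /orP[] /eqP wE; [case/eqP: g1 | case/eqP: g2]; rewrite gE wE.
  have [y' [y'f e1 _]] := meetx _ _ _ f1F gF xf1 xg; have [z' [z'f e2 _]] := meetx _ _ _ f2F gF xf2 xg.
  have yf : y \in g.
    by have : y \in [set x; y'] by [rewrite -e1 f1E !inE eqxx orbT]; rewrite !inE eq_sym (negbTE xy) => /eqP->.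
  have zf : z \in g.
    by have : z \in [set x; z'] by [rewrite -e2 f2E !inE eqxx orbT]; rewrite !inE eq_sym (negbTE xz) => /eqP->.
  by case/eqP: g3; rewrite fE; apply: eq_set2.
exists x; first exact: (subsetP uf1).
exists b => e ce eU; apply/eqP; apply: contraT => eb.
have xe : x \notin e by apply/negP=> /(subsetP eU); rewrite !inE eqxx.
have eU' : e \subset U := subset_trans eU (subsetDl _ _).
(* Members of F disjoint from [e] share its colour, so there is at most one; those meeting [e] join
   [x] to an end of [e], so there are at most two. But F has four members. *)
have : #|[set f : {set T} in F | [disjoint e & f]]| <= 1.
  apply/card_le1_eqP => f g; rewrite !inE -!andbA => /and3P[fE fb df] /and3P[gE gb dg].
  have [cf fU] := E2 _ fE; have [cg gU] := E2 _ gE.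
  by apply: Einj => //; rewrite -(step2 e f) // -(step2 e g).
have : #|[set f : {set T} in F | ~~ [disjoint e & f]]| <= 2.
  rewrite -ce; apply: leq_trans (leq_imset_card (fun y => [set x; y]) e).
  apply: subset_leq_card; apply/subsetP => f; rewrite inE => /andP[fF].
  rewrite -setI_eq0 => /set0Pn[w]; rewrite inE => /andP[we wf]; apply/imsetP; exists w => //.
  have [_ cf _ _] := FP _ fF; apply: eq_set2 => //; first exact: star.
  by apply: contraNneq xe => ->.
have := cardsID [set f : {set T} | [disjoint e & f]] F.
have -> : #|F :&: [set f : {set T} | [disjoint e & f]]| = #|[set f : {set T} in F | [disjoint e & f]]|.
  by apply: eq_card => f; rewrite !inE.
have -> : #|F :\: [set f : {set T} | [disjoint e & f]]| = #|[set f : {set T} in F | ~~ [disjoint e & f]]|.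
  by apply: eq_card => f; rewrite !inE andbC.
by move=> H c2 c1; move: cF; rewrite -H => /leq_trans/(_ (leq_add c1 c2)).
Qed.

End Extend.

Lemma subset_of_card (T : finType) (A : {set T}) k : k <= #|A| -> exists2 B : {set T}, B \subset A & #|B| = k.
Proof.
move=> kA; have : 0 < #|[set B : {set T} | B \subset A & #|B| == k]| by rewrite cards_draws bin_gt0.
by case/card_gt0P=> B; rewrite inE => /andP[BA /eqP]; exists B.
Qed.

(** Since A and Z are disjoint, an unordered pair determines which end lies in A, so nothing is
    counted twice. *)
Lemma sum_pairs_le (T : finType) (A Z : {set T}) (p : pred {set T}) (D : {set {set T}}) :
  [disjoint A & Z] -> (forall x z, x \in A -> z \in Z -> p [set x; z] -> [set x; z] \in D) ->
  \sum_(x in A) #|[set z in Z | p [set x; z]]| <= #|D|.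
Proof.
move=> dAZ pD; pose P := [set xz : T * T | [&& xz.1 \in A, xz.2 \in Z & p [set xz.1; xz.2]]].
have -> : \sum_(x in A) #|[set z in Z | p [set x; z]]| = #|P|.
  rewrite -sum1_card (eq_bigl (fun xz => (xz.1 \in A) && (xz.2 \in [set z in Z | p [set xz.1; z]]))).
    rewrite -(pair_big_dep [in A] (fun x z => z \in [set z in Z | p [set x; z]]) (fun _ _ => 1)) /=.
    by apply: eq_bigr => x _; rewrite sum1_card.
  by move=> [x z]; rewrite !inE.
have <- : #|[set [set xz.1; xz.2] | xz in P]| = #|P|.
  apply: card_in_imset => -[x z] [x' z']; rewrite !inE /=.
  move=> /and3P[xA zZ _] /and3P[x'A z'Z _] eq.
  have : x \in [set x'; z'] by rewrite -eq !inE eqxx.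
  rewrite !inE => /orP[/eqP xx'|/eqP xz']; last by rewrite xz' (disjointFl dAZ z'Z) in xA.
  have : z \in [set x'; z'] by rewrite -eq !inE eqxx orbT.
  rewrite !inE => /orP[/eqP zx'|/eqP zz']; first by rewrite -zx' (disjointFl dAZ zZ) in x'A.
  by rewrite xx' zz'.
apply: subset_leq_card; apply/subsetP=> _ /imsetP[xz + ->].
by rewrite inE => /and3P[]; apply: pD.
Qed.

(** * Extending rainbow matchings through representatives *)

Section Representatives.
Variables (T : finType) (C : eqType) (c : {set T} -> C) (s : nat) (E : {set {set T}}).
Implicit Types (M N R : {set {set T}}) (e f X U Q W A Z : {set T}).
Hypothesis noR : forall M, rainbow_set c M -> #|M| <= s.+1.
Hypothesis E2 : forall e, e \in E -> #|e| = 2.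
Hypothesis Einj : {in E &, injective c}.
Hypothesis Ecov : forall e, #|e| = 2 -> exists2 e', e' \in E & c e' = c e.

Definition rep e := odflt e [pick e' in E | c e' == c e].

Lemma repP e : #|e| = 2 -> rep e \in E /\ c (rep e) = c e.
Proof.
move=> /Ecov[e' e'E ce']; rewrite /rep; case: pickP => [f /andP[fE /eqP]|/(_ e')] //=.
by rewrite e'E ce' eqxx.
Qed.

Definition edge_rel R : rel T := [rel x y | [set x; y] \in E :\: R].

Lemma edge_rel_sym R : symmetric (edge_rel R).
Proof. by move=> x y; rewrite /edge_rel /= setUC. Qed.

Lemma edge_rel_irr R : irreflexive (edge_rel R).
Proof. by move=> x; apply/negP => /setDP[/E2]; rewrite setUid cards1. Qed.

Definition nonnbrs Z x := #|[set z in Z | (z != x) && ([set x; z] \notin E)]|.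

Lemma rainbow_set_of_edge_rel R (r : rel T) (f : {ffun T -> T}) : (forall x y, r x y -> edge_rel R x y) -> imatching r f ->
  exists2 M, rainbow_set c M /\ M \subset E :\: R & cover M = ~: missed f /\ 2 * #|M| = #|~: missed f|.
Proof.
move=> rE mf; apply: (rainbow_set_of_imatching (r := r)) => //.
- by move=> e /setDP[/E2].
- by move=> e e' /setDP[eE _] /setDP[e'E _]; apply: Einj.
Qed.

(* Replacing each edge of [N] by the edge of [E] of the same colour turns the     *)
(* requirement that the colours of [M] and [N] differ into [M] avoiding [rep @: N]. *)
Lemma extend_contra M N : rainbow_set c M -> M \subset E :\: (rep @: N) -> rainbow_set c N ->
  [disjoint cover M & cover N] -> s.+1 < #|M| + #|N| -> False.
Proof.
move=> RM ME RN d big; have [N2 _ _] := RN.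
have [|R cR] := rainbow_set_union RM RN d; last by have := noR R; rewrite cR; lia.
move=> e f eM fN; apply/eqP => cef; have /setDP[eE] := subsetP ME _ eM.
have [rE cr] := repP (N2 _ fN).
by rewrite (_ : e = rep f) ?imset_f //; apply: Einj => //; rewrite cr.
Qed.

(** A rainbow matching of 3 edges outside A has 6 vertices and 3 colours; by hypothesis s - 1 edges
    of E avoid both, which gives s + 2 edges in all. So [no_rainbow3_star] applies outside A, and
    deleting its centre leaves n - (s - 1) - 1 vertices. *)
Lemma dominating_finish (A : {set T}) : 0 < s -> #|A| = s.-1 -> 14 <= #|~: A| ->
  (forall X R, X \subset ~: A -> #|X| <= 6 -> R \subset E -> #|R| <= 3 ->
     exists2 M, rainbow_set c M /\ M \subset E :\: R & [disjoint cover M & X] /\ s.-1 <= #|M|) ->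
  5 <= #|[set e in E | e \subset ~: A]| ->
  exists2 S : {set T}, #|S| = #|T| - s & exists b, forall e, #|e| = 2 -> e \subset S -> c e = b.
Proof.
move=> s0 cA cU ext E5; set U := ~: A.
have [|||x xU [b Hb]] := @no_rainbow3_star T C c U [set e in E | e \subset U] cU _ _ _ E5.
- move=> N' RN' N'U; rewrite leqNgt; apply/negP=> cN'.
  have [N NN' cN] := subset_of_card cN'; have RN := rainbow_set_sub NN' RN'; have [N2 tN _] := RN.
  have [|||| M [RM ME] [dM cM]] := ext (cover N) (rep @: N).
  + apply: subset_trans N'U; apply/bigcupsP=> e eN.
    exact: (bigcup_max e (subsetP NN' _ eN)).
  + by rewrite -(eqP tN) (eq_bigr (fun=> 2)) // sum_nat_const cN.
  + by apply/subsetP=> _ /imsetP[e eN ->]; have [] := repP (N2 _ eN).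
  + by rewrite -cN leq_imset_card.
  by apply: (extend_contra RM ME RN dM); rewrite cN; lia.
- by move=> e; rewrite inE => /andP[/E2].
- by move=> e f; rewrite !inE => /andP[eE _] /andP[fE _]; apply: Einj.
exists (U :\ x); last by exists b.
have := cardsD1 x U; rewrite xU; have := cardsC A; rewrite -/U cA; lia.
Qed.

(* If [A] is not saturated, some [x] in [A] has few neighbours in [W], and all the    *)
(* partners of these neighbours miss the unmatched vertices; dominating_case bounds   *)
(* such defects through the vertex of the barrier with most non-neighbours.           *)
Lemma dominating_extend (A W : {set T}) : #|A| = s.-1 -> [disjoint A & W] ->
  s + 6 <= #|W| ->
  {in A, forall x, nonnbrs W x + \sum_(y in A) nonnbrs W y + 18 < 2 * #|W|} ->
  forall X R, X \subset ~: A -> #|X| <= 6 -> R \subset E -> #|R| <= 3 ->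
  exists2 M, rainbow_set c M /\ M \subset E :\: R & [disjoint cover M & X] /\ s.-1 <= #|M|.
Proof.
move=> cA dAW sW mW X R XA cX RE cR; set Z := W :\: X.
have dAZ : [disjoint A & Z] by apply: disjointWr dAW; apply: subsetDl.
have misR x : x \in A -> #|[set z in Z | ~~ edge_rel R x z]| <= nonnbrs W x + #|[set z in Z | [set x; z] \in R]|.
  move=> xA; apply: leq_trans (leq_card_setU _ _).1.
  apply: subset_leq_card; apply/subsetP => z; rewrite /edge_rel !inE /= !inE negb_and negbK => /andP[/andP[zX zW]].
  rewrite zX zW /=; have -> : z != x by apply: contraTneq xA => <-; rewrite (disjointFl dAW zW).
  by rewrite orbC.
have sumR (B : {set T}) : B \subset A -> \sum_(x in B) #|[set z in Z | [set x; z] \in R]| <= 3.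
  move=> BA; apply: leq_trans cR.
  by apply: sum_pairs_le => [|x z _ _ //]; apply: disjointWl dAZ.
have cZ : #|W| <= #|Z| + 6.
  by have := cardsID X W; have := subset_leq_card (subsetIr W X); rewrite -/Z; lia.
case: (bipartite_saturate (edge_rel_sym R) dAZ) => [[f mf fA]|[x xA [p [pZ sumZ]]]].
  have [M HM [coM cM]] := @rainbow_set_of_edge_rel R _ f (fun x y H => (andP H).1) mf; exists M => //.
  split.
    rewrite coM; apply/pred0P=> z /=; apply/negP=> /andP[]; rewrite !inE => fz zX.
    have [_ /(_ _ fz)] := imatchingP _ _ mf; have := subsetP XA _ zX.
    by rewrite /bipartite /= !inE zX /= => /negbTE ->; rewrite /= !andbF.
  have [ff fe] := imatchingP _ _ mf; rewrite -cA -(leq_pmul2l (isT : 0 < 2)) cM.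
  have fZ x : x \in A -> f x \in Z.
    move=> xA; have := fe _ (fA _ xA); rewrite /bipartite /= xA (disjointFr dAZ xA).
    by rewrite andbF orbF => /andP[].
  have : #|A :|: f @: A| <= #|~: missed f|.
    apply: subset_leq_card; apply/subsetP=> z; rewrite !inE => /orP[/fA//|/imsetP[x xA ->]].
    by rewrite ff eq_sym fA.
  suff /eqP -> : #|A :|: f @: A| == #|A| + #|f @: A|.
    by rewrite card_imset ?mul2n ?addnn //; apply: (can_inj ff).
  rewrite (leq_card_setU _ _).2; apply/pred0P=> z /=; apply/negP=> /andP[zA /imsetP[x xA zx]].
  by have := fZ x xA; rewrite -zx (disjointFr dAZ zA).
have := mW x xA; have := misR x xA; have := sumR [set x]; rewrite big_set1 sub1set xA => /(_ isT).
have : \sum_(y in A) #|[set z in Z | ~~ edge_rel R y z]| <= \sum_(y in A) nonnbrs W y + 3.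
  apply: leq_trans (leq_add (leqnn _) (sumR A (subxx _))).
  by rewrite -big_split /=; apply: leq_sum => y yA; apply: misR.
have U2 : 2 <= #|Z| + 1 - #|A|.
  have : 0 < #|A| by apply/card_gt0P; exists x.
  by rewrite cA; move: cZ sW; clear; move: #|W| #|Z| => w z; lia.
have : p * 2 <= p * (#|Z| + 1 - #|A|) by rewrite leq_mul2l U2 orbT.
move: (p * _) pZ sumZ cZ sW; clear; move: (#|Z|) (#|W|) (nonnbrs W x) (\sum_(y in A) nonnbrs W y).
move: (\sum_(y in A) _) (#|_|) (#|_|) => a b d z w m M q; lia.
Qed.

End Representatives.

Section Clique.
Variables (T : finType) (C : eqType) (c : {set T} -> C) (s : nat) (E : {set {set T}}).
Implicit Types (M N R : {set {set T}}) (e f X U Q W A Z S : {set T}).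
Hypothesis noR : forall M, rainbow_set c M -> #|M| <= s.+1.
Hypothesis E2 : forall e, e \in E -> #|e| = 2.
Hypothesis Einj : {in E &, injective c}.
Hypothesis Ecov : forall e, #|e| = 2 -> exists2 e', e' \in E & c e' = c e.

Lemma star_le1 R x y : (forall e, e \in R -> #|e| = 2) -> x != y ->
  #|[set e in R | x \in e]| + #|[set e in R | y \in e]| <= #|R| + 1.
Proof.
move=> R2 xy; rewrite -cardsUI; apply: leq_add.
  by apply: subset_leq_card; apply/subsetP=> e; rewrite !inE => /orP[] /andP[].
apply/card_le1_eqP => e f; rewrite !inE => /andP[/andP[eR xe] /andP[_ ye]] /andP[/andP[fR xf] /andP[_ yf]].
by rewrite (eq_set2 (R2 _ eR) xe ye xy) (eq_set2 (R2 _ fR) xf yf xy).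
Qed.

Lemma edge_rel_deg R Q S x : R \subset E -> S \subset Q -> x \in S ->
  #|S| <= #|[set z in S | edge_rel E R x z]| + nonnbrs E Q x + #|[set e in R | x \in e]| + 1.
Proof.
move=> RE SQ xS; set N := [set z in S | _].
have : #|[set z in S | [set x; z] \in R]| <= #|[set e in R | x \in e]|.
  rewrite -(@card_in_imset _ _ (fun z => [set x; z])); last first.
    move=> z z' _ _ eq; have : z \in [set x; z'] by rewrite -eq !inE eqxx orbT.
    rewrite !inE => /orP[/eqP zx|/eqP//].
    have : z' \in [set x; z] by rewrite eq !inE eqxx orbT.
    by rewrite !inE zx orbb => /eqP.
  apply: subset_leq_card; apply/subsetP=> _ /imsetP[z + ->]; rewrite !inE => /andP[_ ->].
  by rewrite eqxx.
set B := [set z in S | _]; move=> BR.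
have : #|S| <= #|N :|: [set z in Q | (z != x) && ([set x; z] \notin E)] :|: B :|: [set x]|.
  apply: subset_leq_card; apply/subsetP=> z zS; rewrite /N /B /edge_rel !inE /= !inE zS (subsetP SQ _ zS) /=.
  by case: (z == x); case: (_ \in E); case: (_ \in R).
move=> H; apply: (leq_trans H); apply: leq_trans (leq_card_setU _ _).1 _; rewrite cards1 leq_add2r.
apply: leq_trans (leq_card_setU _ _).1 _; apply: leq_add BR; exact: (leq_card_setU _ _).1.
Qed.

(** Ore's condition in Q minus X with R deleted. The stars of x and y in R have together at most |R|
    + 1 <= 4 edges, so it suffices that |S| is at least 5 more than the non-neighbours of x and y;
    as |S| >= 2s - 2, this follows from 14 <= s. *)
Lemma clique_extend Q : #|Q| = 2 * s -> 14 <= s ->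
  {in Q &, forall x y, x != y -> 3 * (nonnbrs E Q x + nonnbrs E Q y) <= 4 * s + 6} ->
  forall X R, X \subset Q -> ~~ odd #|X| -> #|X| <= 2 -> R \subset E -> #|R| <= 3 ->
  exists2 M, rainbow_set c M /\ M \subset E :\: R & cover M \subset Q :\: X /\ 2 * s <= 2 * #|M| + #|X|.
Proof.
move=> cQ s14 misQ X R XQ oX cX RE cR; set S := Q :\: X.
have SQ : S \subset Q by apply: subsetDl.
have R2 e : e \in R -> #|e| = 2 by move/(subsetP RE)/E2.
have cS : #|S| + #|X| = 2 * s by rewrite -cQ -(cardsID X Q) (setIidPr XQ) addnC.
have [||f mf fS] := @ore_perfect_matching T (edge_rel E R) (edge_rel_sym E R) (edge_rel_irr E2 R) S.
- by move: (congr1 odd cS); rewrite oddD (negbTE oX) mul2n odd_double addbF => ->.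
- move=> x y xS yS xy; have := star_le1 R2 xy.
  have := misQ x y (subsetP SQ _ xS) (subsetP SQ _ yS) xy.
  have := edge_rel_deg RE SQ xS; have := edge_rel_deg RE SQ yS.
  move: cS cX cR s14; clear.
  move: (#|[set z in S | edge_rel E R x z]|) (#|[set z in S | edge_rel E R y z]|) => dx dy.
  move: (#|[set e in R | x \in e]|) (#|[set e in R | y \in e]|) => rx ry.
  move: (nonnbrs E Q x) (nonnbrs E Q y) #|S| #|X| #|R| => mx my k x' r; lia.
have sub x y : induced (edge_rel E R) S x y -> edge_rel E R x y by case/and3P.
have [M [RM ME] [coM cM]] := rainbow_set_of_edge_rel E2 Einj sub mf.
exists M => //; split.
  rewrite coM; apply/subsetP=> z; rewrite inE inE => fz.
  by have [_ /(_ z fz)] := imatchingP _ _ mf; case/and3P.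
have -> : 2 * s = #|S| + #|X| by [].
rewrite leq_add2r cM; apply: subset_leq_card; apply/subsetP=> z zS.
by rewrite !inE fS.
Qed.

(* Edges inside [~: Q] get a single colour [b]. Disjoint edges between [Q] and        *)
(* [~: Q] whose colours are not [b] have equal colours, and by the count of colours   *)
(* representatives of these colours form a star centred at a vertex outside [Q].      *)
Lemma clique_finish Q : #|Q| = 2 * s -> 5 <= #|~: Q| -> 1 <= s ->
  (forall X R, X \subset Q -> ~~ odd #|X| -> #|X| <= 2 -> R \subset E -> #|R| <= 3 ->
    exists2 M, rainbow_set c M /\ M \subset E :\: R & cover M \subset Q :\: X /\ 2 * s <= 2 * #|M| + #|X|) ->
  'C(2 * s, 2) + #|~: Q| + 2 <= #|E| ->
  exists2 W : {set T}, #|W| = 2 * s + 1 &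
    exists b, forall e, #|e| = 2 -> ~~ (e \subset W) -> c e = b.
Proof.
move=> cQ cO s1 ext cE; set O := ~: Q.
(* A rainbow N meeting Q only inside X is completed by s - |X|/2 edges of Q. It is used with X empty
   and two edges, and with |X| = 2 and three edges. *)
have ext' (X : {set T}) (N : {set {set T}}) : X \subset Q -> ~~ odd #|X| -> #|X| <= 2 -> rainbow_set c N ->
    #|N| <= 3 -> [disjoint Q :\: X & cover N] -> 2 * s + 2 < 2 * #|N| + (2 * s - #|X|) -> False.
  move=> XQ oX cX RN cN dN big; have [N2 _ _] := RN.
  have [||M [RM ME] [coM cM]] := ext X (rep c E @: N) XQ oX cX.
  - by apply/subsetP=> _ /imsetP[e eN ->]; have [] := repP Ecov (N2 _ eN).
  - exact: leq_trans (leq_imset_card _ _) cN.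
  apply: (extend_contra noR Einj Ecov RM ME RN).
    exact: disjointWl coM dN.
  move: cM big; clear; move: #|M| #|N| #|X| => a b d; lia.
have step1 e f : #|e| = 2 -> #|f| = 2 -> e \subset O -> f \subset O -> [disjoint e & f] -> c e = c f.
  move=> ce cf eO fO ef; apply/eqP; apply: contraT => nef.
  have [R cN co] := rainbow_set_pair ce cf ef nef.
  case: (ext' set0 [set e; f]); rewrite ?sub0set ?cards0 ?cN //; last by clear; lia.
  by rewrite setD0 co disjoint_sym disjoints_subset subUset eO fO.
have [e0 ce0 e0O] := @exists_pair _ O (leq_trans (isT : 2 <= 5) cO).
have cD (X : {set T}) : #|X| <= 3 -> 2 <= #|O :\: X|.
  move=> cX; rewrite cardsD; have := subset_leq_card (subsetIr O X); move: cX cO; clear.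
  by move: #|O| #|X| #|_| => a b d; lia.
(* An edge meeting [e0] is compared with it through an edge disjoint from both: they cover at most 3
   of the at least 5 vertices of O. *)
set b := c e0; have step2 e : #|e| = 2 -> e \subset O -> c e = b.
  move=> ce eO; have [d|] := boolP [disjoint e & e0]; first exact: step1.
  rewrite -setI_eq0 -card_gt0 => I0.
  have [|g cg gO] := @exists_pair _ (O :\: (e :|: e0)).
    by apply: cD; rewrite cardsU ce ce0; move: I0; clear; move: #|_| => k; lia.
  move: gO; rewrite setDE subsetI -disjoints_subset disjoint_setUr => /and3P[gO d1 d2].
  by rewrite -(step1 g e) // (step1 g e0).
have step3 z o z' o' : z \in Q -> z' \in Q -> o \in O -> o' \in O -> z != z' -> o != o' ->
    c [set z; o] != b -> c [set z'; o'] != b -> c [set z; o] = c [set z'; o'].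
  move=> zQ z'Q oO o'O nz no nb nb'; apply/eqP; apply: contraT => ncol.
  have zo w v : w \in Q -> v \in O -> w != v.
    by move=> wQ; rewrite inE; apply: contraNneq => <-.
  have [|g cg gO] := @exists_pair _ (O :\: [set o; o']); first by apply: cD; rewrite cards2 no.
  move: gO; rewrite setDE subsetI => /andP[gO gno].
  have gQ w : w \in Q -> w \notin g by move=> wQ; apply/negP=> /(subsetP gO); rewrite inE wQ.
  have gO' w : w \in [set o; o'] -> w \notin g.
    by move=> wo; apply/negP=> /(subsetP gno); rewrite inE wo.
  have dis (x1 x2 : T) X : x1 \notin X -> x2 \notin X -> [disjoint [set x1; x2] & X].
    by move=> H1 H2; rewrite disjoint_setUl !disjoints1 H1.
  have [|||||||R cN co] := @rainbow_set_triple T C c [set z; o] [set z'; o'] g _ _ cg _ _ _ ncol _ _.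
  - by rewrite cards2 zo.
  - by rewrite cards2 zo.
  - by apply: dis; rewrite in_set2 negb_or; [rewrite nz zo | rewrite no andbT eq_sym zo].
  - by apply: dis; [apply: gQ | apply: gO'; rewrite !inE eqxx].
  - by apply: dis; [apply: gQ | apply: gO'; rewrite !inE eqxx orbT].
  - by rewrite (step2 g).
  - by rewrite (step2 g).
  case: (ext' [set z; z'] ([set z; o] |: [set [set z'; o']; g])) => //.
  - by rewrite subUset !sub1set zQ.
  - by rewrite cards2 nz.
  - by rewrite cards2 nz.
  - by rewrite cN.
  - rewrite co disjoint_sym !disjoint_setUl !disjoints1 !inE !eqxx !orbT /=.
    move: oO o'O; rewrite !inE => /negbTE-> /negbTE->; rewrite !andbF /=.
    by rewrite disjoint_sym; apply: disjointWl (subsetDl _ _) _; rewrite disjoint_sym disjoints_subset.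
  - by rewrite cN cards2 nz; move: s1; clear; lia.
have zoP e : #|e| = 2 -> ~~ (e \subset Q) -> c e != b ->
    exists z o, [/\ z \in Q, o \in O & e = [set z; o]].
  move=> ce nQ nb; have [o oe oQ] := subsetPn nQ.
  have nO : ~~ (e \subset O) by apply: contra nb => /(step2 e ce)/eqP.
  have [z ze] := subsetPn nO; rewrite inE negbK => zQ; exists z, o; rewrite inE; split=> //.
  by apply: eq_set2 => //; apply: contraNneq oQ => <-.
set F := [set e in E | ~~ (e \subset Q) && (c e != b)].
have FP e : e \in F -> [/\ e \in E, c e != b & exists z o, [/\ z \in Q, o \in O & e = [set z; o]]].
  by rewrite inE => /and3P[eE nQ nb]; split=> //; apply: zoP => //; apply: E2.
(* Only edges inside Q and at most one representative of colour [b] are discarded from E. *)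
have cF : #|O| + 1 <= #|F|.
  have : #|E :\: F| <= 'C(2 * s, 2) + 1.
    apply: (@leq_trans #|[set e : {set T} | e \subset Q & #|e| == 2] :|: [set e in E | c e == b]|).
      apply: subset_leq_card; apply/subsetP=> e; rewrite !inE !negb_and negbK.
      by case/andP=> + eE; rewrite eE E2 // eqxx /= andbT negbK.
    apply: leq_trans (leq_card_setU _ _).1 _; rewrite cards_draws cQ leq_add2l.
    by apply/card_le1_eqP=> e f; rewrite !inE => /andP[eE /eqP eb] /andP[fE /eqP fb];
      apply: Einj => //; rewrite eb fb.
  have FE : F \subset E by apply/subsetP=> e; rewrite inE => /andP[].
  have := cardsID F E; rewrite (setIidPr FE); move: cE; rewrite -/O; clear.
  by move: #|F| #|O| #|E| #|_| 'C(_, _) => a1 a2 a3 a4 a5; lia.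
(* Pigeonhole: F has more edges than O has vertices, and each of its edges has an end in O. *)
have [e1 [e2 [o [e1F e2F ne oO [oe1 oe2]]]]] : exists e1 e2 o,
    [/\ e1 \in F, e2 \in F, e1 != e2, o \in O & o \in e1 /\ o \in e2].
  have [x0 x0e0] : exists x0, x0 \in e0 by apply/card_gt0P; rewrite ce0.
  pose h e := odflt x0 [pick o in O | o \in e].
  have hP e : e \in F -> h e \in O /\ h e \in e.
    move=> eF; rewrite /h; case: pickP => [o /andP[]//|].
    have [_ _ [z [o [_ oO eE]]]] := FP e eF.
    by move=> /(_ o); rewrite oO eE !inE eqxx orbT.
  have /dinjectivePn[e1 e1F [e2 /andP[ne e2F] he]] : ~~ dinjectiveb h F.
    apply/negP => /dinjectiveP/card_in_imset hF; move: cF; rewrite -hF.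
    suff /subset_leq_card : h @: F \subset O by move: #|_| #|_|; clear; lia.
    by apply/subsetP=> _ /imsetP[e eF ->]; case: (hP e eF).
  exists e1, e2, (h e1); have [h1O h1] := hP _ e1F; have [_ h2] := hP _ e2F.
  by split=> //; [rewrite eq_sym | split=> //; rewrite he].
have exz e : e \in F -> o \in e -> exists2 z, z \in Q & e = [set z; o].
  move=> eF oe; have [_ _ [z [o' [zQ o'O eE]]]] := FP e eF; exists z => //.
  move: oe; rewrite eE !inE => /orP[/eqP oz|/eqP-> //].
  by move: oO; rewrite inE oz zQ.
have star e : e \in F -> o \in e.
  move=> eF; apply: contraT => oe; have [eE nb [z [o' [zQ o'O eq]]]] := FP e eF.
  have oo' : o' != o by apply: contraNneq oe => <-; rewrite eq !inE eqxx orbT.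
  (* By [step3] an edge of F avoiding [o] forces every edge of F at [o] through its end [z] in Q,
     and then [e1] and [e2] coincide. *)
  have H e' : e' \in F -> o \in e' -> z \in e'.
    move=> e'F oe'; apply: contraT => ze'; have [z' z'Q e'q] := exz e' e'F oe'.
    have [e'E nb' _] := FP e' e'F.
    have zz' : z != z' by apply: contraNneq ze' => ->; rewrite e'q !inE eqxx.
    have ee' : e = e' by apply: Einj => //; rewrite eq e'q; apply: step3; rewrite -?eq -?e'q.
    by rewrite ee' oe' in oe.
  have zo : z != o by apply: contraTneq zQ => ->; move: oO; rewrite inE.
  have [_ _ _] := FP _ e1F; case/eqP: ne.
  have F2 e' : e' \in F -> #|e'| = 2 by case/FP => /E2.
  by rewrite (eq_set2 (F2 _ e1F) (H _ e1F oe1) oe1 zo) (eq_set2 (F2 _ e2F) (H _ e2F oe2) oe2 zo).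
exists (o |: Q); first by rewrite cardsU1 cQ; move: oO; rewrite inE => ->; rewrite addnC.
exists b => e ce eW; apply/eqP; apply: contraT => nb.
have [|z [o' [zQ o'O eE]]] := zoP e ce _ nb.
  by apply: contra eW => /subset_trans; apply; apply: subsetUr.
have oo' : o' != o.
  by apply: contraNneq eW => o'o; rewrite eE subUset !sub1set !inE zQ o'o eqxx orbT.
(* At most two members of F are excluded: the edge [z o] and the representative of the colour of
   [e]. The remaining [f] contradicts [step3] against [e]. *)
have [f fF [zf ncf]] : exists2 f, f \in F & z \notin f /\ c f != c e.
  have : ~~ (F \subset [set [set z; o]] :|: [set f in E | c f == c e]).
    apply/negP => /subset_leq_card; apply/negP; rewrite -ltnNge.
    apply: leq_ltn_trans (leq_card_setU _ _).1 _; rewrite cards1.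
    have : #|[set f in E | c f == c e]| <= 1.
      by apply/card_le1_eqP=> f f'; rewrite !inE => /andP[fE /eqP fb] /andP[f'E /eqP f'b];
        apply: Einj => //; rewrite fb f'b.
    by move: cF cO; rewrite -/O; clear; move: #|_| #|_| #|_| => a1 a2 a3; lia.
  case/subsetPn=> f fF; rewrite !inE negb_or => /andP[fzo ncf]; exists f => //.
  have fE : f \in E by case: (FP f fF).
  split; last by move: ncf; rewrite fE.
  apply: contra fzo => zf; apply/eqP; apply: eq_set2; [exact: E2 | by []|exact: star|].
  by apply: contraTneq zQ => ->; move: oO; rewrite inE.
have [z' z'Q fq] := exz f fF (star f fF); have [_ fb _] := FP f fF.
case/eqP: ncf; rewrite eE fq; apply: step3; rewrite -?eE -?fq //; last by rewrite eq_sym.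
by apply: contraNneq zf => <-; rewrite fq !inE eqxx.
Qed.

End Clique.

(** * Numerical bounds *)

Lemma bin2_double k : 2 * 'C(k, 2) = k * k.-1.
Proof. by have := mul_bin_diag k 1; rewrite bin1 => <-. Qed.

Lemma bin2_odd d : 'C(2 * d + 1, 2) = d * (2 * d + 1).
Proof. have := bin2_double (2 * d + 1); rewrite addn1 /= => H; nia. Qed.

Lemma bin2_touch n a : a <= n -> 2 * ('C(n, 2) - 'C(n - a, 2)) + a * a + a = 2 * a * n.
Proof.
move=> an; have := bin2_double n; have := bin2_double (n - a).
have : 'C(n - a, 2) <= 'C(n, 2) by apply: leq_bin2l; lia.
have -> : n = a + (n - a) by lia.
move: (n - a) => k; rewrite addKn.
case: k => [|k]; case: a {an} => [|a] /=; rewrite ?addn0 ?add0n; nia.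
Qed.

Lemma g_lower n s t : 0 < s -> s <= n -> g n s <= t ->
  2 * s.-1 * n + 10 <= 2 * t + s.-1 * s /\ (2 * s.-1 + 1) * (2 * s.-1) + 2 * n + 2 <= 2 * t.
Proof.
case: s => [//|s] _ sn; rewrite /g geq_max => /andP[H1 H2].
have -> : s.+1.-1 = s by []. split.
  have := @bin2_touch n s; rewrite (_ : n - s = n - s.+1 + 1); last by lia.
  by move=> H; have := H (ltnW sn); nia.
have := bin2_double (2 * s.+1 - 1); rewrite (_ : 2 * s.+1 - 1 = (2 * s).+1) /=; last by lia.
move: H2; rewrite (_ : 2 * s.+1 - 1 = (2 * s).+1); last by lia.
nia.
Qed.

(** Here d is the half-size of the largest block, r the sum of the other half-sizes, m the least one
    and D' = s - |A|. As x(2x + 1) is superadditive with cross term 4dr, anything but one full block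
    loses about 4D' edges. *)
Lemma class_sum_bound d r m D' : m <= d -> 2 * m <= r -> (0 < r -> 0 < d) -> d + r <= D' -> 2 <= D' ->
  (r = 0 /\ d = D') \/
  d * (2 * d + 1) + r * (2 * r + 1) + 4 * m + 4 * D' <= D' * (2 * D' + 1) + 8.
Proof.
move=> md mr rd dr D2; have [r0|r0] := posnP r.
  subst r; rewrite addn0 in dr; have m0 : m = 0 by lia.
  subst m; have [->|nd] := eqVneq d D'; [by left | right].
  have [k ->] : exists k, D' = d + 1 + k by exists (D' - d - 1); lia.
  nia.
right; have d0 := rd r0.
have H1 : d + r + m <= d * r + 2.
  case: d d0 md {rd dr} => [//|e] _ md; case: r r0 mr => [//|[|q]] _ mr; nia.
have [k kE] : exists k, D' = d + r + k by exists (D' - d - r); lia.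
by subst D'; clear rd mr md; nia.
Qed.

(* The edge bound of the barrier is convex in [a], so only the two smallest and the   *)
(* two largest values of [a] are compatible with the lower bounds on [t].             *)
Lemma barrier_extremes n s a t : 40 <= n -> 2 * s + 5 <= n -> a + 2 <= s ->
  2 * s.-1 * n + 10 <= 2 * t + s.-1 * s -> (2 * s.-1 + 1) * (2 * s.-1) + 2 * n + 2 <= 2 * t ->
  2 * t + a * a + a <= 14 + 2 * a * n + 2 * ((s - a) * (2 * (s - a) + 1)) ->
  a <= 1 /\ 14 <= s.
Proof.
move=> n40 ns as2 G1 G2 H.
have [k sE] : exists k, s = a + k + 2 by exists (s - a - 2); lia.
have sE' : s.-1 = a + k + 1 by lia.
rewrite sE' in G1 G2; rewrite sE (_ : a + k + 2 - a = k + 2) in H; last by lia.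
(* The edge bound at [a] is compared with its value at s - 1; up to a constant the difference is a
   multiple of s - 1 - a = k + 1. *)
have I2 : (k + 1) * (2 * n + 3 * (a + k + a)) <= 8 * (k + 1) * s + 10.
  by rewrite sE in G1 *; clear G2; lia.
have J2 : 2 * n + 3 * (a + k + a) <= 8 * s + 10.
  by rewrite leqNgt; apply/negP=> J; move: (leq_mul (leqnn (k + 1)) J); clear -I2; lia.
have a1 : a <= 1.
  rewrite leqNgt; apply/negP=> a2; have [b aE] : exists b, a = b + 2 by exists (a - 2); lia.
  (* The same comparison with the value at 1, a multiple of a - 1. Cancelling the factors in both
     gives s <= 8, too small for [J2] when n >= 40. *)
  have I1 : 8 * (b + 1) * s <= (b + 1) * (2 * n + 3 * a) + 10.
    by rewrite sE; subst a; clear G1 I2 J2; lia.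
  have J1 : 8 * s <= 2 * n + 3 * a + 10.
    by rewrite leqNgt; apply/negP=> J; move: (leq_mul (leqnn (b + 1)) J); clear -I1; lia.
  clear G1 G2 H I1 I2; lia.
split=> //; have [//|s13] := leqP 14 s; clear G1 G2 H.
(* [J2] leaves only s = 13 and a = 0, where the undivided [I2] fails. *)
have kE : k = 11 by lia.
by subst k; lia.
Qed.

Section Structure.
Variables (T : finType) (C : eqType) (c : {set T} -> C) (s : nat) (E : {set {set T}}).
Implicit Types (M N R : {set {set T}}) (e f X U Q W A Z S K : {set T}).
Hypothesis noR : forall M, rainbow_set c M -> #|M| <= s.+1.
Hypothesis E2 : forall e, e \in E -> #|e| = 2.
Hypothesis Einj : {in E &, injective c}.
Hypothesis Ecov : forall e, #|e| = 2 -> exists2 e', e' \in E & c e' = c e.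

Definition nbrs x := [set y | [set x; y] \in E].

Lemma card_star x : #|[set f in E | x \in f]| <= #|nbrs x|.
Proof.
apply: leq_trans (leq_imset_card (fun y => [set x; y]) (nbrs x)).
apply: subset_leq_card; apply/subsetP=> f; rewrite inE => /andP[fE xf].
have [y xy fxy] := pair_other (E2 fE) xf.
by apply/imsetP; exists y => //; rewrite inE -fxy.
Qed.

Lemma min_nbr_pair : 2 <= #|T| ->
  exists u v, u != v /\ forall t, t \notin [set u; v] -> #|nbrs u| <= #|nbrs t| /\ #|nbrs v| <= #|nbrs t|.
Proof.
move=> T2; have /card_gt0P[x0 _] : 0 < #|T| by apply: leq_trans T2.
case: (@arg_minnP _ x0 xpredT (fun x => #|nbrs x|) isT) => u _ umin.
have /card_gt0P[x1] : 0 < #|~: [set u]| by have := cardsC1 u => ->; move: T2; clear; lia.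
rewrite !inE => x1u.
case: (@arg_minnP _ x1 [pred x | x != u] (fun x => #|nbrs x|) x1u) => v vu vmin.
exists u, v; split; first by rewrite eq_sym.
by move=> t; rewrite !inE negb_or => /andP[tu tv]; split; [apply: umin | apply: vmin].
Qed.

(** * The structure of a representing graph *)

(* A matching of size s + 1 avoiding [u], [v] and the edge with the colour of [uv]    *)
(* would extend by [uv] to a rainbow matching of size s + 2.                         *)
Lemma barrier_structure : 2 * s + 5 <= #|T| ->
  exists u v A (P : {set {set T}}) m, let S := ~: [set u; v] in
    [/\ u != v, A \subset S, partition P (S :\: A), (forall K, K \in P -> odd #|K|)
      & #|A| + \sum_(K in P) #|K|./2 <= s] /\
    [/\ 3 <= #|P|, (forall K, K \in P -> m <= #|K|./2),
      (forall f, f \in E -> f \subset S -> f != rep c E [set u; v] -> [disjoint f & A] ->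
        exists2 K, K \in P & f \subset K)
      & #|[set f in E | ~~ (f \subset S)]| <= 2 * (#|A| + 2 * m + 3)].
Proof.
move=> ns; have [|u [v [uv minuv]]] := min_nbr_pair; first by move: ns; clear; lia.
set S := ~: [set u; v]; set e := rep c E [set u; v].
have c2 : #|[set u; v]| = 2 by rewrite cards2 uv.
have [eE ce] := repP Ecov c2.
have rS := edge_rel_sym E [set e]; have rI := edge_rel_irr E2 [set e].
have [A [P [AS pP eP oP [f mf szf]]]] := barrier rS rI S.
have cADs : #|A| + \sum_(K in P) #|K|./2 <= s.
  have sub x y : induced (edge_rel E [set e]) S x y -> edge_rel E [set e] x y by case/and3P.
  have [M [RM ME] [coM cM]] := rainbow_set_of_edge_rel E2 Einj sub mf.
  have coMS : [disjoint [set u; v] & cover M].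
    rewrite coM disjoint_sym disjoints_subset; apply/subsetP=> x; rewrite inE inE => fx.
    by have [_ /(_ x fx)] := imatchingP _ _ mf; case/and3P.
  have [|RuM cuM] := rainbow_set_add RM c2 coMS.
    move=> e' /(subsetP ME)/setDP[e'E e'e]; apply: contra e'e => /eqP ce'.
    by rewrite inE; apply/eqP; apply: Einj => //; rewrite ce' ce.
  have := noR RuM; rewrite cuM; move: cM szf; have := cardsC (missed f); clear.
  by move: #|M| #|missed f| #|T| #|~: _| (#|A| + _) => m1 m2 m3 m4 m5; lia.
have cP : #|S| = #|A| + (2 * (\sum_(K in P) #|K|./2) + #|P|).
  rewrite -(cardsID A S) (setIidPr AS); congr (_ + _).
  rewrite (card_partition pP) big_distrr /= -sum1_card -big_split /=.
  apply: eq_bigr => K KP; have := odd_double_half #|K|; rewrite oP // -mul2n; clear.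
  by move: #|K| (#|K|./2) => a b; lia.
(* |S| = n - 2 >= 2s + 3, while A and the even parts of the blocks use at most 2s vertices. *)
have q3 : 3 <= #|P|.
  have := cardsC [set u; v]; rewrite c2 -/S; move: cP cADs ns; clear.
  by move: #|S| #|A| #|P| #|T| (\sum_(K in P) _) => a b d k l; lia.
have /card_gt0P[K0 K0P] : 0 < #|P| by apply: leq_trans q3.
case: (@arg_minnP _ K0 [in P] (fun K => #|K|./2) K0P) => Kt KtP minK.
have tiP : trivIset P by case/and3P: pP.
exists u, v, A, P, #|Kt|./2; split=> //; split=> //.
  move=> g gE gS ge gA; have /cards2P[x [y [xy gxy]]] : #|g| == 2 by rewrite E2.
  have SA w : w \in g -> w \in S :\: A.
    by move=> wg; rewrite inE (subsetP gS _ wg) (disjointFr gA wg).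
  have xg : x \in g by rewrite gxy !inE eqxx.
  have yg : y \in g by rewrite gxy !inE eqxx orbT.
  have [|K KP /andP[xK yK]] := eP x y (SA x xg) (SA y yg).
    by rewrite /edge_rel /= inE -gxy gE inE ge.
  by exists K => //; rewrite gxy subUset !sub1set xK.
have /card_gt0P[t tKt] : 0 < #|Kt| by have := oP _ KtP; case: #|Kt|.
have tSA : t \in S :\: A by rewrite -(cover_partition pP); apply/bigcupP; exists Kt.
have [tS tA] := setDP tSA; have tuv : t \notin [set u; v] by move: tS; rewrite inE.
have [du dv] := minuv t tuv.
(* A neighbour of [t] lies in A, in the rest of the smallest block or in {u, v}, or is reached
   through the deleted edge [e]. *)
have dt : #|nbrs t| <= #|A| + 2 * #|Kt|./2 + 3.
  apply: (@leq_trans #|A :|: (Kt :\ t) :|: [set u; v] :|: [set y in nbrs t | [set t; y] == e]|).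
    apply: subset_leq_card; apply/subsetP => y yt; rewrite in_setU.
    have [ye|ye] := boolP ([set t; y] == e); first by rewrite [X in _ || X]inE yt ye orbT.
    move: (yt); rewrite /nbrs in_set => tyE.
    have ty : t != y by apply/negP=> /eqP ty; have := E2 tyE; rewrite ty setUid cards1.
    rewrite 2!in_setU -!orbA; have [//|yA /=] := boolP (y \in A).
    have [yuv|yuv] := boolP (y \in [set u; v]); first by rewrite orbT.
    have yS : y \in S by rewrite inE.
    have [||K KP /andP[tK yK]] := eP t y tSA; first by rewrite inE yA.
      by rewrite /edge_rel /= inE tyE inE ye.
    have <- : K = Kt by rewrite -(def_pblock tiP KP tK) (def_pblock tiP KtP tKt).
    by rewrite !inE eq_sym ty yK.
  have le1 : #|[set y in nbrs t | [set t; y] == e]| <= 1.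
    apply/card_le1_eqP=> y y'; rewrite !inE => /andP[yE /eqP ye] /andP[y'E /eqP y'e].
    have : y \in [set t; y'] by rewrite y'e -ye !inE eqxx orbT.
    rewrite !inE => /orP[/eqP yt|/eqP//].
    by have := E2 yE; rewrite yt setUid cards1.
  apply: leq_trans (leq_card_setU _ _).1 _; rewrite (_ : 3 = 2 + 1) // addnA leq_add //.
  apply: leq_trans (leq_card_setU _ _).1 _; rewrite c2 leq_add2r.
  apply: leq_trans (leq_card_setU _ _).1 _; rewrite leq_add2l.
  have := cardsD1 t Kt; have := odd_double_half #|Kt|; rewrite (oP _ KtP) tKt -mul2n; clear.
  by move: #|Kt| (#|Kt|./2) #|_| => a b d; lia.
apply: (@leq_trans (#|[set f in E | u \in f]| + #|[set f in E | v \in f]|)).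
  apply: leq_trans (leq_card_setU _ _).1; apply: subset_leq_card; apply/subsetP=> g.
  rewrite !inE => /andP[gE]; rewrite gE => /subsetPn[x xg].
  by rewrite !inE negbK => /orP[] /eqP <-; rewrite xg ?orbT.
rewrite mul2n -addnn; apply: leq_add; apply: leq_trans (card_star _) _.
  exact: leq_trans du dt.
exact: leq_trans dv dt.
Qed.

Lemma sum_blocks_le (P : {set {set T}}) :
  \sum_(K in P) #|K|./2 * (2 * #|K|./2 + 1) <=
  (\sum_(K in P) #|K|./2) * (2 * (\sum_(K in P) #|K|./2) + 1).
Proof.
by elim/big_ind2: _ => // a b a' b' H H'; nia.
Qed.

Definition within K := [set f in E | f \subset K].

Lemma card_within K : odd #|K| -> #|within K| <= #|K|./2 * (2 * #|K|./2 + 1).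
Proof.
move=> oK; rewrite -bin2_odd.
have -> : 2 * #|K|./2 + 1 = #|K| by have := odd_double_half #|K|; rewrite oK -mul2n addnC.
rewrite -cards_draws; apply: subset_leq_card; apply/subsetP=> f.
by rewrite !inE => /andP[/E2 -> ->].
Qed.

End Structure.

(** M counts the missing pairs between the barrier and the rest of S; the conclusions feed
    [dominating_extend]. For a = s - 1 a single vertex has at most 5 non-neighbours, hence the term
    5(s - a); for a = s the discarded vertex pays for it. *)
Lemma dominating_numerics n s t M a : 40 <= n -> 2 * s + 5 <= n -> 0 < s ->
  2 * s.-1 * n + 10 <= 2 * t + s.-1 * s -> (2 * s.-1 + 1) * (2 * s.-1) + 2 * n + 2 <= 2 * t ->
  s.-1 <= a <= s ->
  2 * t + 2 * M + a * a + a <= 14 + 2 * a * n + 6 * (s - a) ->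
  s + 6 <= n - 2 - a /\ M + (s - a) * 5 + 18 < 2 * (n - 2 - a).
Proof.
case: s => [//|s] n40 ns _ /= G1 G2 /andP[sa as1] H.
have [aE|aE] : a = s \/ a = s.+1 by lia.
  subst a; rewrite (_ : s.+1 - s = 1) in H *; last by lia.
  have M5 : M <= 5 by clear G2; lia.
  suff : 2 * s + 9 <= n by lia.
  rewrite leqNgt; apply/negP=> n1; have s16 : 16 <= s by lia.
  have : 5 * s * s + 3 * s + 2 * n <= 18 + 2 * s * n by clear G1; lia.
  clear -n1 s16; have [k kE] : exists k, s = k + 16 by exists (s - 16); lia.
  by subst s; have := leq_mul (leqnn (2 * k + 30)) n1; lia.
subst a; rewrite subnn in H *.
have M1 : M + s <= n + 1 by clear G2; lia.
have M2 : 2 * M + 5 * s * s + 5 * s <= 10 + 2 * s * n by clear G1; lia.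
clear G1 G2 H; have [n25|n25] := leqP (25 + s.+1) n.
  suff : 2 * s.+1 + 8 <= n by lia.
  rewrite leqNgt; apply/negP=> n1; have s16 : 16 <= s by lia.
  clear -n1 s16 M2; have [k kE] : exists k, s = k + 16 by exists (s - 16); lia.
  by subst s; have := leq_mul (leqnn (2 * (k + 16))) n1; lia.
have s15 : 15 <= s by lia.
have sE : s = 15.
  have [//|ne] := eqVneq s 15; have s16 : 16 <= s by lia.
  clear -n25 s16 M2; have [k kE] : exists k, s = k + 16 by exists (s - 16); lia.
  by subst s; have := leq_mul (leqnn (2 * (k + 16))) n25; lia.
subst s; lia.
Qed.

(** * The two extremal configurations *)

Section Cases.
Variables (T : finType) (C : eqType) (c : {set T} -> C) (s : nat) (E : {set {set T}}).
Implicit Types (M N R : {set {set T}}) (e f X U Q W A Z S K : {set T}).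
Hypothesis noR : forall M, rainbow_set c M -> #|M| <= s.+1.
Hypothesis E2 : forall e, e \in E -> #|e| = 2.
Hypothesis Einj : {in E &, injective c}.
Hypothesis Ecov : forall e, #|e| = 2 -> exists2 e', e' \in E & c e' = c e.

Definition touching S A := [set f in E | (f \subset S) && ~~ [disjoint f & A]].

Lemma card_touching S A : A \subset S ->
  #|touching S A| + \sum_(x in A) nonnbrs E (S :\: A) x <= 'C(#|S|, 2) - 'C(#|S| - #|A|, 2).
Proof.
move=> AS; set Z := S :\: A.
have cZ : #|Z| = #|S| - #|A| by rewrite cardsD (setIidPr AS).
set D2 := fun X => [set f : {set T} | f \subset X & #|f| == 2].
have Z2S : D2 Z \subset D2 S.
  apply/subsetP=> f; rewrite !inE => /andP[fZ ->]; rewrite andbT.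
  exact: subset_trans fZ (subsetDl _ _).
have -> : 'C(#|S|, 2) - 'C(#|S| - #|A|, 2) = #|D2 S :\: D2 Z|.
  by rewrite cardsD (setIidPr Z2S) !cards_draws cZ.
have tD : touching S A \subset D2 S :\: D2 Z.
  apply/subsetP=> f; rewrite !inE => /and3P[fE fS nd]; rewrite fS E2 // eqxx !andbT.
  apply: contra nd => fZ; rewrite disjoints_subset; apply: subset_trans fZ _.
  by rewrite /Z setDE subsetIr.
rewrite -(cardsID (touching S A) (D2 S :\: D2 Z)) (setIidPr tD) leq_add2l.
have dAZ : [disjoint A & Z] by rewrite disjoint_sym disjoints_subset /Z setDE subsetIr.
apply: (@leq_trans (\sum_(x in A) #|[set z in Z | [set x; z] \notin E]|)).
  apply: leq_sum => x xA; apply: subset_leq_card; apply/subsetP=> z.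
  by rewrite !inE => /and3P[-> _ ->].
apply: (sum_pairs_le (p := [pred f | f \notin E])) => // x z xA zZ /= nE.
have xz : x != z by apply: contraTneq xA => ->; rewrite (disjointFl dAZ zZ).
have zS : z \in S by move: zZ; rewrite inE => /andP[].
rewrite !inE (negbTE nE) cards2 xz !subUset !sub1set zS (subsetP AS _ xA) /= andbT.
by rewrite !inE xA.
Qed.

Lemma card_bigcup_le (P : {set {set T}}) (F : {set T} -> {set {set T}}) :
  #|\bigcup_(K in P) F K| <= \sum_(K in P) #|F K|.
Proof.
elim/big_rec2: _ => [|K X k _ IH]; first by rewrite cards0.
by apply: leq_trans (leq_card_setU _ _).1 _; rewrite leq_add2l.
Qed.

Lemma card_by_barrier e S A (P : {set {set T}}) :
  (forall f, f \in E -> f \subset S -> f != e -> [disjoint f & A] ->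
        exists2 K, K \in P & f \subset K) ->
  #|E| <= #|[set f in E | ~~ (f \subset S)]| + 1 + #|touching S A| + \sum_(K in P) #|within E K|.
Proof.
move=> eP; apply: (@leq_trans #|[set f in E | ~~ (f \subset S)] :|: [set e] :|: touching S A
    :|: \bigcup_(K in P) within E K|).
  apply: subset_leq_card; apply/subsetP=> f fE.
  rewrite in_setU; apply/orP; rewrite !inE fE /=.
  have [fS|] := boolP (f \subset S); last by left.
  have [fe|fe] := eqVneq f e; first by left.
  have [fA|] := boolP [disjoint f & A]; last by left.
  right; have [K KP fK] := eP f fE fS fe fA.
  by apply/bigcupP; exists K => //; rewrite inE fE.
apply: leq_trans (leq_card_setU _ _).1 _; apply: leq_add (card_bigcup_le _ _).
apply: leq_trans (leq_card_setU _ _).1 _; rewrite leq_add2r.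
by apply: leq_trans (leq_card_setU _ _).1 _; rewrite cards1.
Qed.

Lemma dominating_case S A : 40 <= #|T| -> 0 < s -> 2 * s + 5 <= #|T| ->
  g #|T| s <= #|E| -> #|S| = #|T| - 2 -> A \subset S -> s.-1 <= #|A| <= s ->
  2 * #|E| + 2 * (\sum_(x in A) nonnbrs E (S :\: A) x) + #|A| * #|A| + #|A|
    <= 14 + 2 * #|A| * #|T| + 6 * (s - #|A|) ->
  exists2 X : {set T}, #|X| = #|T| - s & exists b, forall e, #|e| = 2 -> e \subset X -> c e = b.
Proof.
move=> n40 s0 ns gE cS AS cA H; set W := S :\: A in H.
have sn : s <= #|T| by move: ns; clear; lia.
have [G1 G2] := g_lower s0 sn gE.
have [N1 N2] := dominating_numerics n40 ns s0 G1 G2 cA H.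
have cW : #|W| = #|T| - 2 - #|A| by rewrite cardsD (setIidPr AS) cS.
have dAW : [disjoint A & W] by rewrite disjoint_sym disjoints_subset /W setDE subsetIr.
have finish (A0 : {set T}) : #|A0| = s.-1 -> [disjoint A0 & W] ->
    {in A0, forall x, nonnbrs E W x + \sum_(y in A0) nonnbrs E W y + 18 < 2 * #|W|} ->
    exists2 X : {set T}, #|X| = #|T| - s & exists b, forall e, #|e| = 2 -> e \subset X -> c e = b.
  move=> cA0 dA0 mA0; apply: (dominating_finish noR E2 Einj Ecov s0 cA0).
  - have := cardsC A0; rewrite cA0; move: n40 ns s0; clear; move: #|~: _| => k; lia.
  - by move=> X R XA cX RE cR; apply: (dominating_extend E2 Einj cA0 dA0) => //; rewrite cW.
  (* The first term of [g] exceeds by 5 the number of pairs meeting s - 1 vertices, so five edges of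
     E avoid [A0]. *)
  have := card_touching (subsetT A0); rewrite cardsT cA0.
  have : #|E| = #|touching setT A0| + #|[set e in E | e \subset ~: A0]|.
    rewrite -(cardsID (touching setT A0) E); congr (_ + _); apply: eq_card => f; rewrite !inE.
      by case: (f \in E); rewrite ?subsetT.
    by rewrite -disjoints_subset subsetT; case: (f \in E); rewrite ?andbF ?andbT //= negbK.
  have nsE : #|T| - s + 1 = #|T| - s.-1 by move: s0 sn; clear; lia.
  move: gE; rewrite /g geq_max nsE => /andP[+ _].
  clear; move: (\sum_(x in A0) _) #|[set e in E | _]| #|E| #|touching _ _| => a1 a2 a3 a4.
  by move: 'C(_, _) 'C(_, _) => a5 a6; lia.
have [cAs|cAs] := eqVneq #|A| s.-1.
  apply: (finish A cAs dAW) => x xA; rewrite cW.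
  have : nonnbrs E W x <= \sum_(y in A) nonnbrs E W y by rewrite (bigD1 x) //= leq_addr.
  have M5 : \sum_(y in A) nonnbrs E W y <= 5.
    move: G1 H; rewrite cAs; move: s0; clear; move: (\sum_(y in A) _) => k.
    case: s => [//|s'] _ /=; rewrite (_ : s'.+1 - s' = 1); last by lia.
    lia.
  move: N2 M5 s0; rewrite cAs; clear; move: (\sum_(y in A) _) (nonnbrs _ _ _) => k l.
  case: s => [//|s'] /=; rewrite (_ : s'.+1 - s' = 1); last by lia.
  lia.
have cAS : #|A| = s by move: cA cAs s0; clear; move: #|A| => k; lia.
have /card_gt0P[y0 y0A] : 0 < #|A| by rewrite cAS.
(* Discarding the vertex with most non-neighbours leaves s - 1 vertices, each with a defect no
   larger than the discarded one. *)
case: (@arg_maxnP _ y0 [in A] (nonnbrs E W) y0A) => x0 x0A maxx0.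
apply: (finish (A :\ x0)).
- by have := cardsD1 x0 A; rewrite x0A cAS => ->.
- exact: disjointWl (subsetDl _ _) dAW.
move=> x /setD1P[_ xA]; have := maxx0 x xA.
move: N2; rewrite cW cAS subnn (big_setD1 x0) //=; clear.
move: (\sum_(y in A :\ x0) _) (nonnbrs _ _ _) (nonnbrs _ _ _) => k l1 l2; lia.
Qed.

End Cases.

Lemma barrier_numerics n s t a d r m F : 40 <= n -> 2 * s + 5 <= n -> a + 2 <= s ->
  2 * s.-1 * n + 10 <= 2 * t + s.-1 * s -> (2 * s.-1 + 1) * (2 * s.-1) + 2 * n + 2 <= 2 * t ->
  m <= d -> 2 * m <= r -> (0 < r -> 0 < d) -> a + (d + r) <= s ->
  2 * F + a * a + a <= 2 * a * (n - 2) ->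
  t <= 2 * (a + 2 * m + 3) + 1 + F + (d * (2 * d + 1) + r * (2 * r + 1)) ->
  [/\ a <= 1, 14 <= s, r = 0 & d = s - a].
Proof.
move=> n40 ns as2 G1 G2 md mr rd adr HF Ht.
have D2 : 2 <= s - a by lia.
have [||X] := class_sum_bound md mr rd _ D2; first by lia.
  case=> r0 dE; have [|a1 s14] := barrier_extremes n40 ns as2 G1 G2; last by split.
  have m0 : m = 0 by lia.
  move: HF Ht; rewrite r0 m0 dE; clear -n40; move: ((s - a) * _) => Q; lia.
have [|a1 s14] := barrier_extremes n40 ns as2 G1 G2.
  move: HF Ht X D2; clear -n40; move: ((s - a) * (2 * (s - a) + 1)) (s - a) => Q k; lia.
(* Without a single full block, the loss in [class_sum_bound] contradicts the second term of [g]
   when a <= 1. *)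
exfalso; case: s => [|s] in as2 G1 G2 ns X s14 adr D2 *; first by [].
case: a => [|[|a]] in a1 HF Ht X D2 as2 adr *; last by [].
  by clear -n40 G2 HF Ht X; rewrite subn0 /= in X G2 *; lia.
by clear -n40 G2 HF Ht X s14; rewrite subSS subn0 /= in X G2 *; lia.
Qed.

Section CliqueCase.
Variables (T : finType) (C : eqType) (c : {set T} -> C) (s : nat) (E : {set {set T}}).
Implicit Types (M N R : {set {set T}}) (e f X U Q W A Z S K B : {set T}).
Hypothesis noR : forall M, rainbow_set c M -> #|M| <= s.+1.
Hypothesis E2 : forall e, e \in E -> #|e| = 2.
Hypothesis Einj : {in E &, injective c}.
Hypothesis Ecov : forall e, #|e| = 2 -> exists2 e', e' \in E & c e' = c e.

Definition nonedges Q := [set f : {set T} | f \subset Q & #|f| == 2] :\: E.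

Lemma card_nonedges Q : #|nonedges Q| + #|within E Q| = 'C(#|Q|, 2).
Proof.
rewrite -cards_draws -(cardsID E [set f : {set T} | f \subset Q & #|f| == 2]) addnC.
congr (_ + _); apply: eq_card => f; rewrite !inE.
by case fE: (f \in E); rewrite ?andbF // (E2 fE) eqxx !andbT.
Qed.

Lemma nonnbrs_nonedges Q x : x \in Q -> nonnbrs E Q x <= #|[set f in nonedges Q | x \in f]|.
Proof.
move=> xQ; rewrite /nonnbrs -(@card_in_imset _ _ (fun z => [set x; z])); last first.
  move=> z z' _; rewrite inE => /and3P[_ z'x _] eq; have : z' \in [set x; z] by rewrite eq !inE eqxx orbT.
  by rewrite !inE (negbTE z'x) => /eqP.
apply: subset_leq_card; apply/subsetP=> _ /imsetP[z + ->]; rewrite !inE => /and3P[zQ zx ->].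
by rewrite subUset !sub1set xQ zQ cards2 [x == z]eq_sym zx !eqxx.
Qed.

Lemma nonedges2 Q e : e \in nonedges Q -> #|e| = 2.
Proof. by rewrite !inE => /and3P[_ _ /eqP]. Qed.

Lemma nonnbrs2 Q x y : x \in Q -> y \in Q -> x != y -> nonnbrs E Q x + nonnbrs E Q y <= #|nonedges Q| + 1.
Proof.
move=> xQ yQ xy; apply: leq_trans (star_le1 (@nonedges2 Q) xy).
by apply: leq_add; apply: nonnbrs_nonedges.
Qed.

Lemma nonnbrs3 Q x y z : x \in Q -> y \in Q -> z \in Q -> x != y -> x != z -> y != z ->
  nonnbrs E Q x + nonnbrs E Q y + nonnbrs E Q z <= #|nonedges Q| + 3.
Proof.
move=> xQ yQ zQ xy xz yz; set st := fun w => [set f in nonedges Q | w \in f].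
have I1 u v : u != v -> #|st u :&: st v| <= 1.
  move=> uv; apply/card_le1_eqP=> e f; rewrite !in_setI !in_set.
  move=> /andP[/andP[eN ue] /andP[_ ve]] /andP[/andP[fN uf] /andP[_ vf]].
  have e2 : #|e| = 2 by apply: (@nonedges2 Q); rewrite in_setD in_set.
  have f2 : #|f| = 2 by apply: (@nonedges2 Q); rewrite in_setD in_set.
  by rewrite (eq_set2 e2 ue ve uv) (eq_set2 f2 uf vf uv).
apply: (@leq_trans (#|st x| + #|st y| + #|st z|)).
  by rewrite !leq_add ?nonnbrs_nonedges.
have := cardsUI (st x) (st y); have := cardsUI (st x :|: st y) (st z).
have : #|st x :|: st y :|: st z| <= #|nonedges Q|.
  by apply: subset_leq_card; rewrite !subUset; apply/andP; split; [apply/andP; split|];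
    apply/subsetP => f; rewrite inE => /andP[].
have : #|(st x :|: st y) :&: st z| <= 2.
  rewrite setIUl; apply: leq_trans (leq_card_setU _ _).1 _.
  by rewrite (leq_add (I1 _ _ xz) (I1 _ _ yz)).
have := I1 _ _ xy; move: #|nonedges Q| #|_ :&: st y| #|_ :&: st z| #|_ :|: st z| #|_ :|: st y|; clear.
by move: #|st x| #|st y| #|st z| => a1 a2 a3 a4 a5 a6 a7 a8; lia.
Qed.

(* For [A = set0] the vertex of [B] with most non-neighbours is discarded: the two    *)
(* other defects of a pair are then at most two thirds of the defects of a triple.    *)
Lemma clique_case S A B : 14 <= s -> 2 * s + 5 <= #|T| -> g #|T| s <= #|E| ->
  #|S| = #|T| - 2 -> A \subset S -> B \subset S -> [disjoint A & B] -> #|A| <= 1 ->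
  #|B| = 2 * (s - #|A|) + 1 ->
  #|E| <= 2 * (#|A| + 3) + 1 + #|touching E S A| + #|within E B| ->
  exists2 W : {set T}, #|W| = 2 * s + 1 &
    exists b, forall e, #|e| = 2 -> ~~ (e \subset W) -> c e = b.
Proof.
move=> s14 ns gE cS AS BS dAB A1 cB cE.
have s0 : 0 < s by apply: leq_trans s14.
have sn : s <= #|T| by move: ns; clear; lia.
have [_ G2] := g_lower s0 sn gE.
(* The bound is 4s + 6 = 2(2s + 3): for empty A, B misses at most 2s pairs, and three stars of
   missing pairs overlap in at most 3. *)
suff [Q cQ mQ] : exists2 Q : {set T}, #|Q| = 2 * s &
    {in Q &, forall x y, x != y -> 3 * (nonnbrs E Q x + nonnbrs E Q y) <= 4 * s + 6}.
  apply: (clique_finish noR E2 Einj Ecov cQ _ s0).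
  - by have := cardsC Q; rewrite cQ; move: ns; clear; move: #|~: Q| #|T| => k n; lia.
  - exact: clique_extend.
  have := cardsC Q; rewrite cQ; have := bin2_double (2 * s); move: G2 s0; clear.
  by move: #|~: Q| #|T| #|E| 'C(_, _) => k n t b; case: s => [//|s']; rewrite /=; nia.
have [A0|cA] : #|A| = 0 \/ #|A| = 1 by move: A1; clear; case: #|A| => [|[|]]; [left|right|].
  rewrite A0 subn0 in cB; have t0 : #|touching E S A| = 0.
    apply/eqP; rewrite cards_eq0 -subset0; apply/subsetP => f; rewrite inE.
    by rewrite (cards0_eq A0) disjoint_sym -setI_eq0 set0I eqxx !andbF.
  have NB : #|nonedges B| <= 2 * s.
    have := card_nonedges B; rewrite cB bin2_odd; move: cE G2 ns s0; rewrite A0 t0; clear.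
    move: #|nonedges B| #|within E B| #|E| #|T| => a1 a2 a3 a4; case: s => [//|s'] /=; lia.
  have /card_gt0P[y0 y0B] : 0 < #|B| by rewrite cB addn1.
  case: (@arg_maxnP _ y0 [in B] (nonnbrs E B) y0B) => z0 z0B maxz0.
  exists (B :\ z0); first by have := cardsD1 z0 B; rewrite z0B cB; clear; move: #|_| => k; lia.
  move=> x y; rewrite !inE => /andP[xz xB] /andP[yz yB] xy.
  have := nonnbrs3 xB yB z0B xy xz yz; have := maxz0 x xB; have := maxz0 y yB.
  have sub w : nonnbrs E (B :\ z0) w <= nonnbrs E B w.
    by apply: subset_leq_card; apply/subsetP => z; rewrite !inE => /andP[/andP[_ ->] ->].
  move: (sub x) (sub y) NB; clear; move: (nonnbrs _ _ _) (nonnbrs _ _ _) (nonnbrs _ _ _) (nonnbrs _ _ _) (nonnbrs _ _ _) #|_|.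
  move=> a1 a2 a3 a4 a5 a6; lia.
have /cards1P[w Aw] : #|A| == 1 by rewrite cA.
set Q := w |: B; have wB : w \notin B by move: dAB; rewrite Aw disjoints1.
have cQ : #|Q| = 2 * s by rewrite cardsU1 wB cB cA; move: s0; clear; lia.
exists Q => //.
have QS : Q \subset S by rewrite subUset BS andbT -Aw.
(* Edges at [w] leaving Q inside S end at distinct vertices of S minus Q. *)
have H : #|touching E S A| + #|within E B| <= #|within E Q| + (#|S| - 2 * s).
  have : touching E S A :&: within E B = set0.
    apply/setP=> f; rewrite !inE; apply/negP=> /andP[/and3P[_ _ +] /andP[_ fB]].
    by rewrite (disjointWl fB) // disjoint_sym.
  have := cardsUI (touching E S A) (within E B) => <- ->; rewrite cards0 addn0.
  have <- : #|S :\: Q| = #|S| - 2 * s by rewrite cardsD (setIidPr QS) cQ.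
  apply: leq_trans (leq_add (leqnn _) (leq_imset_card (fun y => [set w; y]) _)).
  apply: leq_trans (leq_card_setU _ _).1; apply: subset_leq_card; apply/subsetP=> f.
  rewrite !inE => /orP[/and3P[fE fS fA]|/andP[fE fB]]; last first.
    by rewrite fE (subset_trans fB) ?subsetUr.
  rewrite fE /=; have [//|fQ /=] := boolP (f \subset Q).
  have wf : w \in f by apply: contraR fA => wf; rewrite Aw disjoint_sym disjoints1.
  have [y wy fwy] := pair_other (E2 fE) wf.
  apply/imsetP; exists y => //; rewrite inE (subsetP fS) ?fwy ?inE ?eqxx ?orbT // andbT.
  by apply: contra fQ => yQ; rewrite fwy subUset !sub1set !inE eqxx yQ.
have NQ : #|nonedges Q| <= 5.
  have := card_nonedges Q; have := bin2_double (2 * s); rewrite cQ; move: cE H G2 ns s0; rewrite cA cS; clear.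
  move: #|nonedges Q| #|within E Q| #|within _ _| #|touching _ _ _| #|E| #|T| 'C(_, _) => a1 a2 a3 a4 a5 a6 a7.
  by case: s => [//|s'] /=; nia.
move=> x y xQ yQ xy; have := nonnbrs2 xQ yQ xy; move: NQ s14; clear.
move: (nonnbrs _ _ _) (nonnbrs _ _ _) #|_| => a1 a2 a3; lia.
Qed.

End CliqueCase.

Section Dichotomy.
Variables (T : finType) (C : eqType) (c : {set T} -> C) (s : nat) (E : {set {set T}}).
Implicit Types (M N R : {set {set T}}) (e f X U Q W A Z S K B : {set T}).
Hypothesis noR : forall M, rainbow_set c M -> #|M| <= s.+1.
Hypothesis E2 : forall e, e \in E -> #|e| = 2.
Hypothesis Einj : {in E &, injective c}.
Hypothesis Ecov : forall e, #|e| = 2 -> exists2 e', e' \in E & c e' = c e.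

Lemma dichotomy : 0 < s -> 2 * s + 5 <= #|T| -> 40 <= #|T| -> g #|T| s <= #|E| ->
  (exists2 X : {set T}, #|X| = #|T| - s & exists b, forall e, #|e| = 2 -> e \subset X -> c e = b) \/
  (exists2 W : {set T}, #|W| = 2 * s + 1 &
    exists b, forall e, #|e| = 2 -> ~~ (e \subset W) -> c e = b).
Proof.
move=> s0 ns n40 gE.
have [u [v [A [P [m [[uv AS pP oP aD] [q3 minm eP dE]]]]]]] := barrier_structure noR E2 Einj Ecov ns.
set S := ~: [set u; v] in AS pP eP dE.
have cS : #|S| = #|T| - 2.
  by have := cardsC [set u; v]; rewrite cards2 uv -/S => <-; clear; move: #|_| => k; lia.
have an : #|A| <= #|S| := subset_leq_card AS.
have cE := card_by_barrier eP; rewrite -/S in cE.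
have ct := card_touching E2 AS; have F2 := bin2_touch an.
have bound (Y : {set {set T}}) : Y \subset P ->
    \sum_(K in Y) #|within E K| <= (\sum_(K in Y) #|K|./2) * (2 * (\sum_(K in Y) #|K|./2) + 1).
  move=> YP; apply: leq_trans (sum_blocks_le Y); apply: leq_sum => K KY.
  by apply: card_within E2 _ (oP K (subsetP YP K KY)).
have summ (Y : {set {set T}}) : Y \subset P -> #|Y| * m <= \sum_(K in Y) #|K|./2.
  move=> YP; rewrite -sum_nat_const; apply: leq_sum => K KY.
  exact: minm (subsetP YP K KY).
have [as1|as2] := leqP s.-1 #|A|.
  left; apply: (dominating_case noR E2 Einj Ecov n40 s0 ns gE cS AS).
    by rewrite as1; move: aD; clear; lia.
  have := bound P (subxx _); have := summ P (subxx _).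
  move: (\sum_(K in P) #|K|./2) aD => D aD m3 wP.
  have D1 : D <= 1 by move: aD as1 s0; clear; lia.
  (* At least three blocks of half-size at least m share a total of at most 1. *)
  have m0 : m = 0.
    have := leq_trans (leq_mul q3 (leqnn m)) m3; move: D1; clear; lia.
  have wP3 : \sum_(K in P) #|within E K| <= 3 * (s - #|A|).
    apply: leq_trans wP _; case: D D1 aD {m3} => [//|[|//]] _ aD.
    by move: aD; clear; lia.
  move: cE dE ct F2 wP3; rewrite cS m0; move: ns; clear.
  move: (\sum_(K in P) _) (\sum_(K in A) _) ('C(_, _) - _) => a1 a2 a3.
  move: #|touching _ _ _| #|[set f in E | _]| #|E| #|A| #|T| => a4 a5 a6 a7 a8.
  move=> ns; have [k ->] : exists k, a8 = k + 2 by exists (a8 - 2); lia.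
  by rewrite addnK; lia.
have [K0 K0P] : exists K, K \in P by apply/card_gt0P; apply: leq_trans q3.
case: (@arg_maxnP _ K0 [in P] (fun K => #|K|./2) K0P) => B BP maxB.
set d := #|B|./2 in maxB; pose Y := P :\ B; pose r := \sum_(K in Y) #|K|./2.
have YP : Y \subset P by apply: subsetDl.
have DE : \sum_(K in P) #|K|./2 = d + r by rewrite (big_setD1 B).
have wE : \sum_(K in P) #|within E K| = #|within E B| + \sum_(K in Y) #|within E K|.
  by rewrite (big_setD1 B).
have wB : #|within E B| <= d * (2 * d + 1) by apply: card_within (oP B BP).
have wY := bound Y YP; rewrite -/r in wY.
have md : m <= d := minm B BP.
have mr : 2 * m <= r.
  apply: leq_trans (summ Y YP); apply: leq_mul => //.
  by move: q3; rewrite (cardsD1 B P) BP add1n ltnS.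
have rd : 0 < r -> 0 < d.
  move=> r0; rewrite lt0n; apply: contraTneq r0 => d0; rewrite -leqNgt leqn0 /r.
  rewrite big1 // => K KY; apply/eqP; rewrite -leqn0 -d0.
  exact: maxB (subsetP YP K KY).
have sn : s <= #|T| by move: ns; clear; lia.
have [G1 G2] := g_lower s0 sn gE.
have as2' : #|A| + 2 <= s by move: as2 s0; clear; lia.
rewrite DE in aD; rewrite cS in ct F2.
have [|a1 s14 r0 dE'] := barrier_numerics n40 ns as2' G1 G2 md mr rd aD (eq_leq F2).
  move: cE dE ct wB wY; rewrite wE; clear.
  move: (_ * _) (_ * _) (\sum_(K in A) _) (\sum_(K in Y) _) ('C(_, _) - _) => a1 a2 a3 a4 a5.
  by move: #|touching _ _ _| #|within _ _| #|[set f in E | _]| #|E| #|A| => a6 a7 a8 a9 a0; lia.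
right; have BS : B \subset S :\: A by rewrite -(cover_partition pP); apply: (bigcup_max B).
apply: (clique_case noR E2 Einj Ecov s14 ns gE cS AS (B := B)) => //.
- exact: subset_trans BS (subsetDl _ _).
- by rewrite disjoint_sym disjoints_subset; apply: subset_trans BS _; rewrite setDE subsetIr.
- by have := odd_double_half #|B|; rewrite (oP B BP) -/d dE' -mul2n addnC => <-.
move: wY; rewrite r0 mul0n leqn0 => /eqP wY.
have m0 : m = 0 by move: mr; rewrite r0; clear; lia.
by move: cE dE; rewrite wE wY m0 addn0; clear; lia.
Qed.

End Dichotomy.

(** * Transfer to the definitions of the statement *)

Section Transfer.
Variables (n : nat) (C : eqType) (c : edge_coloring (complete n) C).

Lemma edges_complete (e : {set 'I_n}) : (e \in edges (complete n)) = (#|e| == 2).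
Proof.
apply/imset2P/cards2P => [[x y _ ] | [x [y [xy ->]]]].
  by rewrite inE => /andP[_ xy] ->; exists x, y.
by exists x y; rewrite ?inE.
Qed.

Lemma representatives : exists E : {set {set 'I_n}},
  [/\ forall e, e \in E -> #|e| = 2, {in E &, injective c},
    forall e : {set 'I_n}, #|e| = 2 -> exists2 e', e' \in E & c e' = c e & #|E| = num_colors c].
Proof.
(* The choice depends on [e] only through its colour, which makes [c] injective on the chosen
   edges. *)
pose rp (e : {set 'I_n}) : {set 'I_n} := odflt e [pick e' : {set 'I_n} | (#|e'| == 2) && (c e' == c e)].
have rpP (e : {set 'I_n}) : #|e| = 2 -> #|rp e| = 2 /\ c (rp e) = c e.
  move=> e2; rewrite /rp; case: pickP => [e' /andP[/eqP e'2 /eqP]|/(_ e)] //=.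
pose E := [set rp e | e : {set 'I_n} & #|e| == 2].
have EP (e : {set 'I_n}) : e \in E -> exists2 e' : {set 'I_n}, #|e'| = 2 & e = rp e'.
  by case/imsetP=> e'; rewrite inE => /eqP; exists e'.
have Einj : {in E &, injective c}.
  move=> _ _ /EP[e e2 ->] /EP[f f2 ->]; have [_ ->] := rpP e e2; have [_ ->] := rpP f f2.
  move=> ef; rewrite /rp; have -> : [pick e' : {set 'I_n} | (#|e'| == 2) && (c e' == c e)] =
    [pick e' : {set 'I_n} | (#|e'| == 2) && (c e' == c f)] by apply: eq_pick => e' /=; rewrite ef.
  by case: pickP => [//|/(_ f)]; rewrite f2 !eqxx.
have rpE (e : {set 'I_n}) : #|e| = 2 -> rp e \in E.
  by move=> e2; apply: imset_f; rewrite inE e2.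
exists E; split=> //.
- by move=> _ /EP[e e2 ->]; have [] := rpP e e2.
- by move=> e e2; exists (rp e); [apply: rpE | have [] := rpP e e2].
rewrite /num_colors cardE -(size_map c); apply/eqP.
rewrite -uniq_size_uniq.
- by rewrite map_inj_in_uniq ?enum_uniq // => e f; rewrite !mem_enum; apply: Einj.
- exact: undup_uniq.
move=> x; rewrite mem_undup; apply/mapP/mapP => -[e]; rewrite mem_enum.
  rewrite edges_complete => /eqP e2 ->; exists (rp e); first by rewrite mem_enum rpE.
  by have [] := rpP e e2.
move=> /EP[e' e'2 ->] ->; exists (rp e') => //; rewrite mem_enum edges_complete.
by have [->] := rpP e' e'2.
Qed.

Lemma has_rainbow_of_set k (M : {set {set 'I_n}}) : rainbow_set c M -> k <= #|M| -> has_rainbow_matching c k.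
Proof.
move=> RM kM; have [N NM cN] := subset_of_card kM; have [N2 tN iN] := rainbow_set_sub NM RM.
exists N; split=> //; rewrite /matching tN andbT; apply/subsetP=> e /N2.
by rewrite edges_complete => ->.
Qed.

Lemma monochromatic_copy (F : sgraph) (f : F -> 'I_n) b : injective f ->
  (forall x y : F, adj x y -> x != y -> c [set f x; f y] = b) ->
  has_monochromatic c F.
Proof.
move=> finj fb; exists f.
have eP e : e \in copy_edges (G := complete n) f ->
    exists x y : F, [/\ adj x y, x != y & e = [set f x; f y]].
  case/imsetP=> e' /imset2P[x y _]; rewrite inE => /andP[_ xy] -> ->; exists x, y; split=> //.
    by apply: contraTneq xy => ->; rewrite adj_irrefl.
  by rewrite imsetU !imset_set1.
split=> //.
  apply/subsetP=> e /eP[x [y [_ xy ->]]].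
  by rewrite edges_complete cards2 (inj_eq finj) xy.
by move=> e e' /eP[x [y [a1 n1 ->]]] /eP[x' [y' [a2 n2 ->]]]; rewrite !fb.
Qed.

Lemma monochromatic_complete (X : {set 'I_n}) k b : #|X| = k ->
  (forall e : {set 'I_n}, #|e| = 2 -> e \subset X -> c e = b) ->
  has_monochromatic c (complete k).
Proof.
move=> cX Xb; pose f (i : 'I_k) : 'I_n := enum_val (cast_ord (esym cX) i).
have finj : injective f by apply: inj_comp enum_val_inj (@cast_ord_inj _ _ _).
apply: (@monochromatic_copy (complete k) f b finj) => x y _ xy; apply: Xb.
  by rewrite cards2 (inj_eq finj) xy.
by rewrite subUset !sub1set !enum_valP.
Qed.

(** The edgeless side is placed on W and the clique on its complement, so every edge of the join has
    an end outside W. *)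
Lemma monochromatic_join (W : {set 'I_n}) k l b : #|~: W| = k -> #|W| = l ->
  (forall e : {set 'I_n}, #|e| = 2 -> ~~ (e \subset W) -> c e = b) ->
  has_monochromatic c (join (complete k) (compl (complete l))).
Proof.
move=> cW' cW Wb.
pose f (u : ('I_k + 'I_l)%type) : 'I_n := match u with
  | inl i => enum_val (cast_ord (esym cW') i)
  | inr j => enum_val (cast_ord (esym cW) j) end.
have fl i : f (inl i) \notin W by have := enum_valP (cast_ord (esym cW') i); rewrite inE.
have fr j : f (inr j) \in W by apply: enum_valP.
have finj : injective f.
  move=> [i|i] [j|j] ij.
  - by congr inl; move: ij => /enum_val_inj/cast_ord_inj.
  - by have := fl i; rewrite ij fr.
  - by have := fl j; rewrite -ij fr.
  - by congr inr; move: ij => /enum_val_inj/cast_ord_inj.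
apply: (@monochromatic_copy (join (complete k) (compl (complete l))) f b finj) => x y axy xy.
apply: Wb; first by rewrite cards2 (inj_eq finj) xy.
rewrite subUset !sub1set negb_and; case: x y axy xy => [i|i] [j|j] axy xy; rewrite ?fl ?orbT //.
by move: axy; rewrite /= /compl_adj /= /complete_adj negbK andNb.
Qed.

End Transfer.

Theorem theorem1p1 (n s : nat) (hn : 0 < n) (hs : 0 < s)
    (hns : maxn (2 * s + 5) 40 <= n)
    (C : eqType) (c : edge_coloring (complete n) C)
    (hc : g n s <= num_colors c)
    (hM : ~ has_rainbow_matching c (s + 2)) :
  has_monochromatic c (complete (n - s)) \/
  has_monochromatic c
    (join (complete (n - 2 * s - 1)) (compl (complete (2 * s + 1)))).
Proof.
move: hns; rewrite geq_max => /andP[ns n40].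
have [E [E2 Einj Ecov cE]] := representatives c.
have noR (M : {set {set 'I_n}}) : rainbow_set c M -> #|M| <= s.+1.
  by move=> RM; rewrite leqNgt; apply/negP => big; apply: hM; apply: (has_rainbow_of_set RM); rewrite addn2.
rewrite -cE -[n in g n]card_ord in hc; rewrite -[n]card_ord in ns n40.
case: (dichotomy noR E2 Einj Ecov hs ns n40 hc) => [[X cX [b Xb]]|[W cW [b Wb]]].
  by left; apply: monochromatic_complete Xb; rewrite cX card_ord.
right; apply: monochromatic_join Wb => //.
by rewrite -subnDA -cW -[n in n - _]card_ord -(cardsC W) addKn.
Qed.
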